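(* Let $\alpha$ be irrational and let $c>0$ be a constant. For any integer $K \ge 0$ and any integer $N$ with $q_K \le N<q_{K+1}$, \[ \sum_{\substack{n=1 \\ \{ n \alpha \} \ge c/N}}^N \frac{1}{\{ n \alpha \}} = N \log N + O \left( (\mathds{1}_{\{ K+1 \textrm{ odd} \}}a_{K+1}^{1/2} + \log s_{K+1})N \right) . \] If in addition $4 (ca_{K+1})^{1/2} q_K \le N$ and $K+1$ is odd, then \[ \sum_{\substack{n=1 \\ \{ n \alpha \} \ge c/N}}^N \frac{1}{\{ n \alpha \}} \ge N \log N + q_{K+1} - O((\log s_{K+1})N) . \] These implied constants depend only on $c$. Further, for any integer $K \ge 0$ and any integer $N$ with $q_K \le N < q_{K+1}$, \[ \sum_{n=1}^N \frac{1}{n \{ n \alpha \}} = \frac{1}{2} (\log N)^2 + \frac{\pi^2}{6} \sum_{\substack{1 \le k \le K \\ k \textrm{ odd}}} a_k + \mathds{1}_{\{ K+1 \textrm{ odd} \}} a_{K+1} \sum_{1 \le j \le N/q_K} \frac{1}{j^2} +O \Bigg( \sum_{\substack{1 \le k \le K+1 \\ k \textrm{ odd}}} a_k^{1/2} \log a_k + (\log s_{K+1}) \log N \Bigg) \] with a universal implied constant.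
   Context: $\{ x \}$ denotes the fractional part of $x$, and $\mathds{1}_{\{P\}}$ equals $1$ if $P$ holds and $0$ otherwise. $\alpha = [a_0; a_1, a_2, \ldots]$ is the continued fraction expansion of $\alpha$, with convergents $p_k/q_k = [a_0;a_1,\ldots,a_k]$ (so $q_0=1$), and $s_K = \sum_{k=1}^K a_k$. In error terms, $\log x$ means $\log \max\{e,x\}$. *)

(* Defs.v *)
From HB Require Import structures.
From mathcomp Require Import all_boot all_order all_algebra.
From mathcomp Require Import all_classical all_reals all_analysis.

Set Implicit Arguments.
Unset Strict Implicit.
Unset Printing Implicit Defensive.

Import Order.TTheory GRing.Theory Num.Theory.
Local Open Scope ring_scope.

Section ContinuedFractions.
Variable R : realType.
Implicit Types (x alpha : R) (K k : nat).

Definition fpart x : R := x - (Num.floor x)%:~R.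

(* Iterates of x |-> 1 / {x}; for irrational alpha the fractional part never
   vanishes, so the junk value 0^-1 = 0 does not occur. *)
Definition complete_quot alpha k : R := iter k (fun x => (fpart x)^-1) alpha.

(* The partial quotient a_k in alpha = [a_0; a_1, a_2, ...]. *)
Definition pquot alpha k : int := Num.floor (complete_quot alpha k).

(* The value [b_0; b_1, ..., b_m] of a finite continued fraction; the innermost
   term is b_m + 0^-1 = b_m. *)
Definition cf_value (s : seq int) : rat :=
  foldr (fun b v => b%:~R + v^-1) 0 s.

Definition convergent alpha k : rat := cf_value (mkseq (pquot alpha) k.+1).

(* The denominator of the k-th convergent in lowest terms. *)
Definition cf_den alpha k : nat := `|denq (convergent alpha k)|%N.

Definition pquot_sum alpha K : int := \sum_(1 <= k < K.+1) pquot alpha k.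

(* Convention: log x in error terms means log max(e, x). *)
Definition elog x : R := ln (Num.max (expR 1) x).

Definition recip_sum (c : R) alpha (N : nat) : R :=
  \sum_(1 <= n < N.+1 | c / N%:R <= fpart (n%:R * alpha))
     (fpart (n%:R * alpha))^-1.

Definition weighted_recip_sum alpha (N : nat) : R :=
  \sum_(1 <= n < N.+1) (n%:R * fpart (n%:R * alpha))^-1.

End ContinuedFractions.

(* Main.v *)
(* Write q = q_K, p = p_K, q' = q_(K+1), a = a_(K+1) and |q alpha - p| = 1/D, so
   that q' < D <= q' + q.  For 0 < n < q' one has {n alpha} = (r + t)/q, where r is
   the residue of n p (K even) or n p - 1 (K odd) modulo q and t in (0, 1) is n/D
   or 1 - n/D.  Over q consecutive values of n the residue r runs through
   0, ..., q - 1, hence the n with r <> 0 contribute q ln q + O(q) to the sum of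
   1/{n alpha}.  Residue 0 behaves differently according to the parity of K: for K
   even it means n = j q with {n alpha} = j/D, and these "special" n are set aside;
   for K odd it means n = q' - i q with 1/{n alpha} <= D/i, a total of
   O(N (1 + ln a)) over n <= N.

   Writing N = B q + M with M < q (so that M <= N/2) and iterating on M, the sum G(N)
   of 1/{n alpha} over the non-special n <= N is N ln N + O(L N), where L bounds all
   1 + ln a_k, k <= K + 1.  The special n below q contribute only O(L q), and those
   between q and N an explicit sum of D/j, on which the cutoff c/N acts; this gives
   the first two estimates.  For the weighted sum, the non-special n are treated by
   partial summation from G, and the special ones at level k give
   (a_(k+1) + O(1)) * sum of 1/j^2, with sum 1/j^2 = pi^2/6 + O(1/a_(k+1)) when the
   level is complete. *)

Require Import Defs.
From HB Require Import structures.
From mathcomp Require Import all_boot all_order all_algebra.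
From mathcomp Require Import all_classical all_reals all_analysis.
From mathcomp Require Import zify ring lra.

Set Implicit Arguments.
Unset Strict Implicit.
Unset Printing Implicit Defensive.

Import Order.TTheory GRing.Theory Num.Theory numFieldNormedType.Exports.
Local Open Scope ring_scope.

(** * Harmonic and logarithmic sums *)

Section LogSums.
Variable R : realType.
Implicit Types (n N : nat) (x C : R).

(** Both bounds are ln (1 + x) <= x, taken at x = -1/(n+1) and at x = 1/n. *)
Lemma ln_natS_bounds n : (0 < n)%N ->
  n.+1%:R^-1 <= ln n.+1%:R - ln n%:R :> R /\ ln n.+1%:R - ln n%:R <= n%:R^-1 :> R.
Proof.
move=> n0.
have nR : 0 < n%:R :> R by rewrite ltr0n.
have SR : 0 < n.+1%:R :> R by rewrite ltr0n.
rewrite -ln_div ?posrE//; split.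
  rewrite -lerN2 -lnV ?posrE ?divr_gt0// invf_div.
  have -> : n%:R / n.+1%:R = 1 + - n.+1%:R^-1 :> R.
    by rewrite -(@natr1 _ n); field; rewrite natr1 gt_eqF.
  by apply: le_ln1Dx; rewrite ltrN2 invf_lt1// ltr1n.
have -> : n.+1%:R / n%:R = 1 + n%:R^-1 :> R.
  by rewrite -(@natr1 _ n); field; rewrite gt_eqF.
apply: le_ln1Dx; rewrite (@lt_trans _ _ 0)// ?ltrN10// invr_gt0//.
Qed.

Lemma ln_nat_ge0 n : 0 <= ln n%:R :> R.
Proof.
case: n => [|n]; first by rewrite ln0.
by apply: ln_ge0; rewrite ler1n.
Qed.

Lemma ler_ln_nat m n : (m <= n)%N -> ln m%:R <= ln n%:R :> R.
Proof.
case: m => [|m] mn; first by rewrite ln0// ln_nat_ge0.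
by rewrite ler_ln ?ler_nat// posrE ltr0n// (leq_trans _ mn).
Qed.

Lemma ln_nat_le n : (0 < n)%N -> ln n%:R <= n%:R - 1 :> R.
Proof.
move=> n0; have := @le_ln1Dx R (n%:R - 1).
rewrite subrKC; apply.
by rewrite ltrBrDl addrN ltr0n.
Qed.

Definition harmonic_sum n : R := \sum_(1 <= j < n.+1) j%:R^-1.

Lemma harmonic_sumS n : harmonic_sum n.+1 = harmonic_sum n + n.+1%:R^-1.
Proof. by rewrite /harmonic_sum big_nat_recr. Qed.

Lemma harmonic_sum_ge0 n : 0 <= harmonic_sum n.
Proof. by apply: sumr_ge0 => i _; rewrite invr_ge0. Qed.

Lemma harmonic_sum_le n : harmonic_sum n <= 1 + ln n%:R.
Proof.
case: n => [|n]; first by rewrite /harmonic_sum big_geq// ln0// addr0.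
elim: n => [|n IH].
  by rewrite /harmonic_sum big_nat1 invr1 ln1 addr0.
rewrite harmonic_sumS.
have [+ _] := @ln_natS_bounds n.+1 isT.
by move: (ln n.+2%:R) (ln n.+1%:R) n.+2%:R^-1 IH => b c d; lra.
Qed.

Lemma harmonic_sum_ge n : ln n.+1%:R <= harmonic_sum n.
Proof.
elim: n => [|n IH]; first by rewrite ln1 harmonic_sum_ge0.
rewrite harmonic_sumS.
have [_] := @ln_natS_bounds n.+1 isT.
by move: (ln n.+2%:R) (ln n.+1%:R) n.+1%:R^-1 IH => b c d; lra.
Qed.

Lemma invsq_sum_le2 n : \sum_(1 <= j < n.+1) (j%:R ^+ 2)^-1 <= 2 :> R.
Proof.
(* The subtracted term makes the induction close, since 1/j^2 <= 1/(j-1) - 1/j. *)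
suff H m : \sum_(1 <= j < m.+2) (j%:R ^+ 2)^-1 <= 2 - m.+1%:R^-1 :> R.
  case: n => [|n]; first by rewrite big_geq.
  by apply: le_trans (H n) _; rewrite gerBl invr_ge0.
elim: m => [|m IH]; first by rewrite big_nat1 expr1n invr1; lra.
rewrite big_nat_recr//=.
apply: le_trans (lerD IH (lexx _)) _.
have m0 : 0 < m.+1%:R :> R by rewrite ltr0n.
rewrite -(@natr1 _ m.+1); set y := m.+1%:R in m0 *.
have -> : 2 - y^-1 + ((y + 1) ^+ 2)^-1 = 2 - (y + 1)^-1 - (y * (y + 1) ^+ 2)^-1.
  by field; rewrite !gt_eqF//; lra.
by rewrite gerBl invr_ge0 mulr_ge0 ?sqr_ge0// ltW.
Qed.

(** Summation by parts: the boundary term S_N/(N+1) is at most C, and the terms S_n/(n(n+1)) add up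
    to at most C times a harmonic sum. *)
Lemma abel_bound (h : nat -> R) C N : 0 <= C ->
  (forall n, (n <= N)%N -> `|\sum_(1 <= m < n.+1) h m| <= C * n%:R) ->
  `|\sum_(1 <= n < N.+1) h n / n%:R| <= C * (2 + ln N%:R).
Proof.
move=> C0 hS; set S := fun n => \sum_(1 <= m < n.+1) h m.
have -> : \sum_(1 <= n < N.+1) h n / n%:R =
    S N / N.+1%:R + \sum_(1 <= n < N.+1) S n / (n%:R * n.+1%:R).
  elim: {hS} N => [|n IH]; first by rewrite /S !big_geq// mul0r addr0.
  rewrite big_nat_recr//= IH [in RHS]big_nat_recr//=.
  have -> : S n.+1 = S n + h n.+1 by rewrite /S big_nat_recr.
  rewrite -(@natr1 _ n.+1); have n0 : 0 < n.+1%:R :> R by rewrite ltr0n.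
  by field; rewrite !gt_eqF//; lra.
apply: (le_trans (ler_normD _ _)).
have HN : `|S N / N.+1%:R| <= C.
  rewrite normrM [X in _ * X]ger0_norm ?invr_ge0// ler_pdivrMr ?ltr0n//.
  by apply: le_trans (hS N (leqnn _)) _; rewrite ler_wpM2l// ler_nat.
suff HS : `|\sum_(1 <= n < N.+1) S n / (n%:R * n.+1%:R)| <= C * harmonic_sum N.
  by move: (ler_wpM2l C0 (harmonic_sum_le N)) => ?; lra.
apply: (le_trans (ler_norm_sum _ _ _)).
rewrite /harmonic_sum mulr_sumr [leLHS]big_nat_cond [leRHS]big_nat_cond.
apply: ler_sum => i /andP[/andP[i1 iN] _].
have i0 : 0 < i%:R :> R by rewrite ltr0n.
rewrite normrM [X in _ * X]ger0_norm ?invr_ge0 ?mulr_ge0//.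
apply: le_trans (ler_wpM2r _ (hS i _)) _; rewrite ?invr_ge0 ?mulr_ge0//.
rewrite -mulrA ler_wpM2l// invfM mulrA mulfV ?gt_eqF// mul1r lef_pV2 ?posrE ?ltr0n//.
by rewrite ler_nat.
Qed.

(** Discrete form of (x ln x)'/x = ((ln x)^2/2)' + 1/x. It lets the increments of n ln n, divided by
    n, telescope to (ln N)^2/2 up to a harmonic sum. *)
Lemma ln_increment_bound n : (0 < n)%N ->
  `|(n%:R * ln n%:R - n.-1%:R * ln n.-1%:R) / n%:R
    - (2^-1 * ln n%:R ^+ 2 - 2^-1 * ln n.-1%:R ^+ 2)| <= 2 * n%:R^-1 :> R.
Proof.
case: n => [//|[|n]] _ /=.
  by rewrite ln1 ln0// !mulr0 expr0n/= !mulr0 !subr0 mul0r normr0.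
set l := ln n.+2%:R; set m := ln n.+1%:R.
have [] := @ln_natS_bounds n.+1 isT; rewrite -/l -/m => d1 d2.
have ll : l <= n.+1%:R.
  by apply: le_trans (@ln_nat_le n.+2 isT) _; rewrite -(@natr1 _ n.+1) addrK.
have l0 : 0 <= l by exact: ln_nat_ge0.
rewrite -(@natr1 _ n.+1) in d1 *; set y := n.+1%:R in d1 d2 ll *.
have y1 : 1 <= y by rewrite ler1n.
have y0 : 0 < y by lra.
have y10 : 0 < y + 1 by lra.
(* The first term is small because l <= y and l - m exceeds 1/(y+1) by at most 1/y - 1/(y+1); the
   other two because l - m <= 1/y. *)
have -> : ((y + 1) * l - y * m) / (y + 1) - (2^-1 * l ^+ 2 - 2^-1 * m ^+ 2) =
  l * ((y + 1)^-1 - (l - m)) + y * (y + 1)^-1 * (l - m) + 2^-1 * (l - m) ^+ 2.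
  by field; rewrite gt_eqF.
have : 0 < (y + 1)^-1 by rewrite invr_gt0.
have : (y + 1)^-1 <= 2^-1 by rewrite lef_pV2 ?posrE//; lra.
have : y * y^-1 = 1 by rewrite mulfV// gt_eqF.
have : (y + 1) * (y + 1)^-1 = 1 by rewrite mulfV// gt_eqF.
have : y^-1 <= 1 by rewrite invf_le1.
have : 0 < y^-1 by rewrite invr_gt0.
set d := l - m in d1 d2 *.
move: (y + 1)^-1 y^-1 d d1 d2 => z w d d1 d2 w0 w1 zE wE z2 z0.
have wz : w = z + w * z by move: zE wE; nra.
have A1 : l * (d - z) <= z.
  apply: le_trans (_ : y * (w * z) <= _); last by rewrite mulrA wE mul1r.
  by apply: ler_pM => //; lra.
have A2 : 0 <= l * (d - z) by rewrite mulr_ge0//; lra.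
have A3 : y * z * d <= z.
  rewrite -[leRHS]mulr1 -wE mulrA (mulrC z y) ler_wpM2l// ltW// mulr_gt0//; lra.
have A4 : 0 <= y * z * d by rewrite !mulr_ge0//; lra.
have A5 : d ^+ 2 <= w by rewrite expr2; nra.
have A6 : 0 <= d ^+ 2 by rewrite sqr_ge0.
have A7 : w <= 2 * z by nra.
have -> : l * (z - d) = - (l * (d - z)) by ring.
by rewrite ler_norml; apply/andP; split; lra.
Qed.

(* Summation by parts against the model sequence whose partial sums are n ln n. *)
Lemma weighted_sum_bound (g : nat -> R) C N : 0 <= C ->
  (forall n, (n <= N)%N ->
     `|\sum_(1 <= m < n.+1) g m - n%:R * ln n%:R| <= C * n%:R) ->
  `|\sum_(1 <= n < N.+1) g n / n%:R - 2^-1 * ln N%:R ^+ 2|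
    <= (C + 2) * (2 + ln N%:R).
Proof.
move=> C0 hg.
pose g0 n : R := n%:R * ln n%:R - n.-1%:R * ln n.-1%:R.
have tel (F : nat -> R) n : \sum_(1 <= m < n.+1) (F m - F m.-1) = F n - F 0%N.
  by rewrite big_add1 /= telescope_sumr.
have sg0 n : \sum_(1 <= m < n.+1) g0 m = n%:R * ln n%:R.
  by rewrite /g0 (tel (fun m => m%:R * ln m%:R)) mul0r subr0.
have A : `|\sum_(1 <= n < N.+1) (g n - g0 n) / n%:R| <= C * (2 + ln N%:R).
  by apply: abel_bound => // n nN; rewrite sumrB sg0; exact: hg.
have B : `|\sum_(1 <= n < N.+1) g0 n / n%:R - 2^-1 * ln N%:R ^+ 2|
    <= 2 * harmonic_sum N.
  have -> : 2^-1 * ln N%:R ^+ 2 =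
      \sum_(1 <= n < N.+1) (2^-1 * ln n%:R ^+ 2 - 2^-1 * ln n.-1%:R ^+ 2) :> R.
    rewrite (tel (fun m => 2^-1 * ln m%:R ^+ 2))/=.
    by rewrite (_ : ln 0%:R = 0) ?expr0n ?mulr0 ?subr0//; exact: ln0.
  rewrite -sumrB (le_trans (ler_norm_sum _ _ _))// /harmonic_sum mulr_sumr.
  rewrite [leLHS]big_nat_cond [leRHS]big_nat_cond.
  by apply: ler_sum => i /andP[/andP[i1 _] _]; exact: ln_increment_bound.
have -> : \sum_(1 <= n < N.+1) g n / n%:R - 2^-1 * ln N%:R ^+ 2 =
   \sum_(1 <= n < N.+1) (g n - g0 n) / n%:R +
   (\sum_(1 <= n < N.+1) g0 n / n%:R - 2^-1 * ln N%:R ^+ 2).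
  rewrite addrA; congr (_ - _); rewrite -big_split/=; apply: eq_bigr => i _.
  by rewrite -mulrDl subrK.
apply: (le_trans (ler_normD _ _)).
by move: (harmonic_sum_le N) (@ln_nat_ge0 N) => ? ?; lra.
Qed.

End LogSums.

(** * The Basel sum with an explicit tail *)

Section Basel.
Variable R : realType.
Implicit Types (x : R) (n m B : nat).

(** By the mean value theorem sin x = x cos c with c between 0 and x, where cos decreases. *)
Lemma sin_bounds x : 0 < x < pi / 2 -> x * cos x <= sin x <= x.
Proof.
move=> /andP[x0 xpi].
have [|c] := @MVT_segment R sin cos 0 x (ltW x0) (fun y _ => is_derive_sin y).
  by apply: continuous_subspaceT => y; exact: continuous_sin.
rewrite in_itv/= => /andP[c0 cx].
have pi0 := @pi_gt0 R.
rewrite sin0 !subr0 => ->; rewrite (mulrC (cos c)).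
rewrite ler_pM2l// ger_pMr// cos_le1 andbT.
rewrite leNgt ltr_cos ?in_itv/= -?leNgt//; apply/andP; split; lra.
Qed.

(** Upper bound: 1/sin^2 = cot^2 + 1 and cot x <= 1/x. *)
Lemma csc2_bounds x : 0 < x < pi / 2 ->
  (x ^+ 2)^-1 <= (sin x ^+ 2)^-1 <= (x ^+ 2)^-1 + 1.
Proof.
move=> xb; have /andP[lb ub] := sin_bounds xb.
have s0 := sin_gt0_pihalf xb; have /andP[x0 xp] := xb.
have c0 : 0 < cos x by apply: cos_gt0_pihalf; apply/andP; split; lra.
apply/andP; split; first by rewrite lef_pV2 ?posrE ?exprn_gt0// ler_pXn2r// nnegrE ltW.
have E : (sin x ^+ 2)^-1 = (cos x / sin x) ^+ 2 + 1.
  by rewrite expr_div_n cos2sin2; field; rewrite gt_eqF.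
have q : cos x / sin x <= x^-1.
  by rewrite ler_pdivrMr// -(ler_pM2l x0) mulrA mulfV ?gt_eqF// mul1r.
rewrite E lerD2r -exprVn ler_pXn2r// nnegrE; last by rewrite invr_ge0 ltW.
by rewrite divr_ge0// ltW.
Qed.

(* Hofbauer's proof of the Basel identity: iterating this duplication formula from
   1/sin^2(pi/4) = 2 evaluates the sums of 1/sin^2 over the odd angles below. *)
Lemma csc2_double x : sin x != 0 -> cos x != 0 ->
  (sin x ^+ 2)^-1 + (cos x ^+ 2)^-1 = 4 * (sin (x *+ 2) ^+ 2)^-1.
Proof.
move=> s0 c0; rewrite sin_mulr2n -mulr_natl.
transitivity ((cos x ^+ 2 + sin x ^+ 2) / (sin x ^+ 2 * cos x ^+ 2)).
  by field; rewrite s0 c0.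
by rewrite cos2Dsin2; field; rewrite s0 c0.
Qed.

(** For k < 2^n these are the odd multiples of pi/2^(n+2) inside (0, pi/2). *)
Definition odd_angle n k : R := pi * k.*2.+1%:R / 2 ^+ n.+2.

Lemma odd_angle_bounds n k : (k < 2 ^ n)%N -> 0 < odd_angle n k < pi / 2.
Proof.
move=> kn; have pi0 := @pi_gt0 R; have e0 : 0 < 2 ^+ n.+2 :> R by rewrite exprn_gt0.
rewrite /odd_angle; apply/andP; split; first by rewrite divr_gt0// mulr_gt0// ltr0n.
rewrite -mulrA ltr_pM2l// ltr_pdivrMr//.
by rewrite exprS mulKf// -natrX ltr_nat expnS; lia.
Qed.

Lemma sum_csc2_odd_angles n :
  \sum_(0 <= k < 2 ^ n) (sin (odd_angle n k) ^+ 2)^-1 = 2 * 4 ^+ n.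
Proof.
elim: n => [|n IH].
  rewrite expn0 big_nat1 /odd_angle.
  have -> : pi * 0.*2.+1%:R / 2 ^+ 2 = pi / 4 :> R by rewrite mulr1 -natrX.
  have c0 : cos (pi / 4) != 0 :> R.
    have pi0 := @pi_gt0 R.
    by rewrite gt_eqF//; apply: cos_gt0_pihalf; apply/andP; split; lra.
  have := @tan_piquarter R; rewrite /tan => /(congr1 (fun z => z * cos (pi / 4))).
  rewrite divfK// mul1r => E; rewrite E.
  have := cos2Dsin2 (pi / 4 : R); rewrite E => E2.
  have c2 : cos (pi / 4 : R) ^+ 2 != 0 by rewrite expf_neq0.
  by apply: (mulIf c2); rewrite mulVf// expr0; lra.
have -> : (2 ^ n.+1 = 2 ^ n + 2 ^ n)%N by rewrite expnS; lia.
rewrite (@big_cat_nat _ _ _ (2 ^ n))//= ?leq_addr//.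
(* The upper half is reversed, so that each angle x is paired with pi/2 - x, whose sine is cos x;
   the duplication formula then lands on the angle 2x of level n. *)
rewrite -{2}[(2 ^ n)%N]add0n big_addn addnK [X in _ + X]big_nat_rev/= add0n -big_split/=.
rewrite exprS mulrCA -IH mulr_sumr big_nat_cond [RHS]big_nat_cond.
apply: eq_bigr => k /andP[/andP[_ kn] _].
have pi0 := @pi_gt0 R.
have b1 : 0 < odd_angle n.+1 k < pi / 2 by apply: odd_angle_bounds; rewrite expnS; lia.
have E1 : odd_angle n.+1 (2 ^ n - k.+1 + 2 ^ n) = pi / 2 - odd_angle n.+1 k.
  rewrite /odd_angle.
  have -> : (2 ^ n - k.+1 + 2 ^ n).*2.+1%:R = 2 ^+ n.+2 - k.*2.+1%:R :> R.
    by rewrite -natrX -natrB; [congr _%:R; rewrite !expnS|rewrite !expnS]; lia.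
  by rewrite mulrBr mulrBl [2 ^+ n.+3]exprS; field; rewrite expf_neq0.
rewrite E1 -[sin (pi / 2 - _)]opprK -sinN opprB sinBpihalf opprK.
rewrite csc2_double.
- congr (4 * (sin _ ^+ 2)^-1); rewrite /odd_angle [2 ^+ n.+3]exprS -mulr_natl.
  by field; rewrite expf_neq0.
- by rewrite gt_eqF// sin_gt0_pihalf.
- have /andP[? ?] := b1; rewrite gt_eqF//; apply: cos_gt0_pihalf.
  by apply/andP; split; lra.
Qed.

Definition odd_invsq_sum m : R := \sum_(0 <= k < m) (k.*2.+1%:R ^+ 2)^-1.
Definition invsq_sum B : R := \sum_(1 <= j < B.+1) (j%:R ^+ 2)^-1.

(** The bounds on 1/sin^2 are summed over the odd angles, where the exact total is 2 * 4^n. The 2^n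
    error terms equal to 1 become (pi^2/16)/2^n after rescaling. *)
Lemma odd_invsq_sum_bounds n :
  odd_invsq_sum (2 ^ n) <= pi ^+ 2 / 8 <= odd_invsq_sum (2 ^ n) + (2 ^+ n)^-1.
Proof.
have pi0 := @pi_gt0 R; have e0 : 0 < 2 ^+ n :> R by rewrite exprn_gt0.
have E : \sum_(0 <= k < 2 ^ n) (odd_angle n k ^+ 2)^-1 =
    16 * 4 ^+ n / pi ^+ 2 * odd_invsq_sum (2 ^ n).
  rewrite /odd_invsq_sum mulr_sumr; apply: eq_bigr => k _.
  rewrite /odd_angle (_ : 4 ^+ n = (2 ^+ n) ^+ 2); last first.
    by rewrite -!natrX -expnM mulnC expnM.
  rewrite ![2 ^+ _.+1]exprS; have : 0 < k.*2.+1%:R :> R by rewrite ltr0n.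
  move: (pi : R) pi0 (2 ^+ n : R) e0 (k.*2.+1%:R : R) => p p0 e e0 y y0.
  by field; rewrite !gt_eqF.
have A : \sum_(0 <= k < 2 ^ n) (odd_angle n k ^+ 2)^-1 <= 2 * 4 ^+ n.
  rewrite -sum_csc2_odd_angles big_nat_cond [leRHS]big_nat_cond.
  by apply: ler_sum => k /andP[/andP[_ /odd_angle_bounds/csc2_bounds/andP[]]].
have B : 2 * 4 ^+ n <= \sum_(0 <= k < 2 ^ n) (odd_angle n k ^+ 2)^-1 + 2 ^+ n.
  rewrite -sum_csc2_odd_angles.
  have -> : 2 ^+ n = \sum_(0 <= k < 2 ^ n) 1 :> R.
    by rewrite sumr_const_nat subn0 natrX.
  rewrite -big_split/= [leLHS]big_nat_cond [leRHS]big_nat_cond.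
  by apply: ler_sum => k /andP[/andP[_ /odd_angle_bounds/csc2_bounds/andP[]]].
have F : 4 ^+ n = 2 ^+ n * 2 ^+ n :> R by rewrite -exprMn -natrM.
have f0 : 0 < 4 ^+ n :> R by rewrite exprn_gt0.
have s0 : 0 <= odd_invsq_sum (2 ^ n).
  by apply: sumr_ge0 => i _; rewrite invr_ge0 exprn_ge0.
move: A B; rewrite E => A B; set O := odd_invsq_sum _ in s0 A B *.
have p0 : 0 < pi ^+ 2 :> R by rewrite exprn_gt0.
have P16 : pi ^+ 2 <= 16 :> R by have := @pihalf_lt2 R; nra.
move: (pi ^+ 2 : R) p0 A B P16 => P p0 A B P16.
apply/andP; split.
  rewrite -(ler_pM2l f0) -(ler_pM2l (_ : 0 < 16 / P)) ?divr_gt0//.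
  by move: A; congr (_ <= _); field; rewrite gt_eqF.
apply: le_trans (_ : O + P / 16 * (2 ^+ n)^-1 <= _); last first.
  by rewrite lerD2l ger_pMl ?invr_gt0// ler_pdivrMr// mul1r.
rewrite -(ler_pM2l f0) -(ler_pM2l (_ : 0 < 16 / P)) ?divr_gt0//.
by move: B; congr (_ <= _); rewrite ?F; field; rewrite ?gt_eqF.
Qed.

(** The even terms reproduce a quarter of the sum up to m. *)
Lemma invsq_sum_double m :
  invsq_sum m.*2 = odd_invsq_sum m + invsq_sum m / 4.
Proof.
elim: m => [|m IH]; first by rewrite /invsq_sum /odd_invsq_sum !big_geq// mul0r addr0.
rewrite doubleS /invsq_sum big_nat_recr//= big_nat_recr//= -/(invsq_sum _) IH.
rewrite /odd_invsq_sum big_nat_recr//= /invsq_sum [X in _ = _ + X / 4]big_nat_recr//=.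
rewrite (_ : m.*2.+2%:R = 2 * m.+1%:R); last by rewrite -natrM; congr _%:R; lia.
by field; rewrite ?natr1 ?gt_eqF ?ltr0n.
Qed.

(** pi^2/6 is the fixed point of z = pi^2/8 + z/4, so doubling the length divides the error by 4 and
    adds at most 1/2^n. *)
Lemma basel_pow2 n : `|pi ^+ 2 / 6 - invsq_sum (2 ^ n)| <= 4 / 2 ^+ n.
Proof.
have p2 := @pihalf_lt2 R; have p1 := @pihalf_ge1 R.
elim: n => [|n IH].
  rewrite /invsq_sum expn0 big_nat1 expr0 expr1n ler_norml.
  by apply/andP; split; nra.
rewrite expnS mul2n invsq_sum_double.
have /andP[lo hi] := odd_invsq_sum_bounds n.
have -> : pi ^+ 2 / 6 - (odd_invsq_sum (2 ^ n) + invsq_sum (2 ^ n) / 4) =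
   (pi ^+ 2 / 8 - odd_invsq_sum (2 ^ n)) + (pi ^+ 2 / 6 - invsq_sum (2 ^ n)) / 4.
  by field.
have -> : 4 / 2 ^+ n.+1 = 2 * (2 ^+ n)^-1 :> R.
  by rewrite exprS; field; rewrite expf_neq0.
set w := (2 ^+ n)^-1 in IH lo hi *.
set d := pi ^+ 2 / 6 - _ in IH *; move: IH; rewrite !ler_norml => /andP[? ?].
by apply/andP; split; lra.
Qed.

(** Telescoping of 1/(j+1)^2 <= 1/j - 1/(j+1). *)
Lemma invsq_sum_tail B m : (0 < B)%N ->
  0 <= invsq_sum (B + m) - invsq_sum B <= B%:R^-1 - (B + m)%:R^-1.
Proof.
move=> B0; elim: m => [|m /andP[IH1 IH2]]; first by rewrite addn0 !subrr lexx.
rewrite addnS /invsq_sum big_nat_recr//= -/(invsq_sum _) addrAC.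
have c0 : 0 < (B + m)%:R :> R by rewrite ltr0n addn_gt0 B0.
have : ((B + m).+1%:R ^+ 2)^-1 <= (B + m)%:R^-1 - (B + m).+1%:R^-1 :> R.
  rewrite -(@natr1 _ (B + m)); set y := (B + m)%:R in c0 *.
  have -> : y^-1 - (y + 1)^-1 = ((y + 1) * y)^-1.
    by field; rewrite !gt_eqF//; lra.
  rewrite lef_pV2 ?posrE ?exprn_gt0 ?mulr_gt0//; [nra|lra|lra].
have : 0 <= ((B + m).+1%:R ^+ 2)^-1 :> R by rewrite invr_ge0 exprn_ge0.
move: IH1 IH2; rewrite -/(invsq_sum _); move: (invsq_sum _ - _) (_ ^- 2) => u v.
move: (B%:R^-1 : R) (_.+1%:R^-1 : R) (_%:R^-1 : R) => x y z *.
by apply/andP; split; lra.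
Qed.

(** Comparison with the largest power of two 2^n below the length: the error there is 4/2^n, the
    tail adds 1/2^n, and 1/2^n is at most 4 over the length plus one, whence 20. *)
Lemma basel_bound B : `|pi ^+ 2 / 6 - invsq_sum B| <= 20 / B.+1%:R.
Proof.
case: B => [|B].
  rewrite /invsq_sum big_geq// subr0 divr1 ger0_norm; last by rewrite divr_ge0 ?sqr_ge0.
  by have := @pihalf_lt2 R; have := @pihalf_ge1 R; nra.
set n := trunc_log 2 B.+1.
have /andP[n1 n2] : (2 ^ n <= B.+1 < 2 ^ n.+1)%N by apply: trunc_log_bounds.
have := @invsq_sum_tail (2 ^ n) (B.+1 - 2 ^ n); rewrite expn_gt0/= subnKC//.
move=> /(_ isT)/andP[t1 t2]; have := basel_pow2 n.
have e0 : 0 < 2 ^+ n :> R by rewrite exprn_gt0.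
have : (2 ^ n)%:R^-1 <= 4 / B.+2%:R :> R.
  rewrite ler_pdivlMr ?ltr0n// mulrC ler_pdivrMr ?ltr0n ?expn_gt0//.
  by rewrite -natrM ler_nat; rewrite expnS in n2; lia.
have : 0 <= B.+1%:R^-1 :> R by rewrite invr_ge0.
rewrite -natrX; move: t1 t2.
move: (invsq_sum _) (invsq_sum _) (_^-1) (_^-1) (_^-1) (pi ^+ 2 / 6) => s1 s2 x y z p t1 t2 ? ?; rewrite !ler_norml => /andP[? ?].
by apply/andP; split; lra.
Qed.

End Basel.

(** * Continued fractions *)

(* With (u, v) = (0, 1) and (1, 0) this gives the numerators and the denominators
   of the convergents [b_0; ..., b_k], shifted by two: p_k and q_k have index k + 2. *)
Fixpoint continuant (b : nat -> int) (u v : int) (k : nat) : int :=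
  match k with
  | 0%N => u
  | k1.+1 => match k1 with
             | 0%N => v
             | k0.+1 => b k0 * continuant b u v k1 + continuant b u v k0
             end
  end.

Arguments continuant : simpl never.

Section Continuants.
Variable b : nat -> int.
Hypothesis b_gt0 : forall k, 0 < b k.+1.
Local Notation P := (continuant b 0 1).
Local Notation Q := (continuant b 1 0).

Lemma continuantSS u v k :
  continuant b u v k.+2 = b k * continuant b u v k.+1 + continuant b u v k.
Proof. by []. Qed.

Lemma continuant_det k : P k.+1 * Q k - P k * Q k.+1 = (-1) ^+ k.
Proof.
elim: k => [|k IH]; first by rewrite expr0 mulr1 mul0r subr0.
by rewrite exprS -IH !continuantSS; ring.
Qed.

Lemma continuant_den_gt0 k : 0 < Q k.+2 /\ 0 <= Q k.+1.
Proof.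
elim: k => [|k [IH1 IH2]]; first by rewrite /continuant mulr0 add0r.
split; last exact: ltW.
by rewrite continuantSS; apply: ltr_wpDr => //; rewrite mulr_gt0.
Qed.

(** A continued fraction with last entry x is a Moebius transformation of x. Only b_0 may fail to be
    positive; the induction replaces x by b_k + 1/x, which is positive unless k = 0, hence the form
    of the hypothesis. *)
Lemma foldr_continuant (F : realFieldType) k (x : F) : k = 0%N \/ 0 < x ->
  foldr (fun c v => c%:~R + v^-1) x (mkseq b k) =
  (x * (P k.+1)%:~R + (P k)%:~R) / (x * (Q k.+1)%:~R + (Q k)%:~R).
Proof.
elim: k x => [|k IH] x; first by rewrite /continuant /= => _; field.
move=> [//|x0].
rewrite mkseqS foldr_rcons IH; last first.
  case: k {IH} => [|k]; [by left|right].
  by rewrite addr_gt0 ?invr_gt0// ltr0z.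
rewrite !continuantSS !rmorphD !rmorphM /=.
have d0 : x * ((b k)%:~R * (Q k.+1)%:~R + (Q k)%:~R) + (Q k.+1)%:~R != 0 :> F.
  rewrite gt_eqF// -rmorphM -rmorphD -continuantSS.
  have [A B] := continuant_den_gt0 k.
  by rewrite ltr_wpDr ?ler0z// mulr_gt0// ltr0z.
have d1 : x * (((b k)%:~R + x^-1) * (Q k.+1)%:~R + (Q k)%:~R) =
    x * ((b k)%:~R * (Q k.+1)%:~R + (Q k)%:~R) + (Q k.+1)%:~R.
  by field; rewrite gt_eqF.
have d2 : ((b k)%:~R + x^-1) * (Q k.+1)%:~R + (Q k)%:~R != 0 :> F.
  by apply: contraNneq d0 => E; rewrite -d1 E mulr0.
apply/eqP; rewrite eqr_div// -d1; apply/eqP.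
by move: d2; set d := _ + (Q k)%:~R => d2; field; rewrite gt_eqF.
Qed.

(** The determinant identity is a Bezout relation. *)
Lemma coprime_continuants k : coprimez (P k) (Q k).
Proof.
apply/coprimezP; exists ((-1) ^+ k.+1 * Q k.+1, (-1) ^+ k * P k.+1) => /=.
transitivity ((-1) ^+ k * (P k.+1 * Q k - P k * Q k.+1)); first by rewrite exprS; ring.
by rewrite continuant_det -exprMn_comm ?mulrNN ?mulr1 ?expr1n//; exact: commr_refl.
Qed.

Lemma cf_value_continuant k :
  cf_value (mkseq b k.+1) = (P k.+2)%:~R / (Q k.+2)%:~R.
Proof.
rewrite /cf_value mkseqS foldr_rcons invr0 addr0 foldr_continuant; last first.
  by case: k => [|k]; [left|right; rewrite ltr0z].
by rewrite !continuantSS !rmorphD !rmorphM.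
Qed.

Lemma denq_cf_value k : `|denq (cf_value (mkseq b k.+1))|%N%:Z = Q k.+2.
Proof.
have [A _] := continuant_den_gt0 k.
rewrite cf_value_continuant coprimeq_den ?gt_eqF//; last exact: coprime_continuants.
by rewrite absz_id gtz0_abs.
Qed.

End Continuants.

(** * Complete quotients of an irrational number *)

Section Expansion.
Variable R : realType.
Implicit Types (x alpha : R).

Lemma fpart_ge0 x : 0 <= fpart x.
Proof. by rewrite /fpart subr_ge0 floor_le. Qed.

Lemma fpart_lt1 x : fpart x < 1.
Proof.
by have /andP[_] := floor_itv x; rewrite /fpart rmorphD ltrBlDl addrC; rewrite addrC.
Qed.

Lemma irrational_fpart_gt0 x : irrational x -> 0 < fpart x.
Proof.
move=> ix; rewrite lt_neqAle fpart_ge0 andbT eq_sym; apply/eqP => E; apply: ix.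
exists (Num.floor x)%:~R => //; rewrite ratr_int.
by apply/esym/eqP; rewrite -subr_eq0 -/(fpart x) E.
Qed.

Lemma irrational_fpartV x : irrational x -> irrational (fpart x)^-1.
Proof.
move=> ix [y _ E]; apply: ix; exists (y^-1 + (Num.floor x)%:~R) => //.
by rewrite rmorphD/= fmorphV/= ratr_int E invrK /fpart subrK.
Qed.

Lemma irrational_complete_quot alpha k : irrational alpha ->
  irrational (complete_quot alpha k).
Proof. by move=> ia; elim: k => //= k IH; exact: irrational_fpartV. Qed.

Lemma complete_quotS alpha k :
  complete_quot alpha k.+1 = (fpart (complete_quot alpha k))^-1.
Proof. by []. Qed.

Lemma complete_quot_gt1 alpha k : irrational alpha -> 1 < complete_quot alpha k.+1.
Proof.
move=> ia; rewrite complete_quotS invf_gt1 ?fpart_lt1//.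
by apply: irrational_fpart_gt0; exact: irrational_complete_quot.
Qed.

Lemma pquot_gt0 alpha k : irrational alpha -> 0 < pquot alpha k.+1.
Proof.
by move=> ia; rewrite ltNge floor_le0 -leNgt ltW// complete_quot_gt1.
Qed.

Lemma complete_quot_expansion alpha k : irrational alpha ->
  alpha = foldr (fun c v => c%:~R + v^-1) (complete_quot alpha k) (mkseq (pquot alpha) k).
Proof.
move=> ia; elim: k => [//|k IH].
by rewrite mkseqS foldr_rcons complete_quotS invrK /fpart addrC subrK.
Qed.

End Expansion.

(* The data of level K of a continued fraction: q = q_K, q' = q_(K+1), a = a_(K+1),
   p = p_K, e = odd K and 1 / D = |q_K alpha - p_K|. *)
Record cf_level (R : realType) (alpha : R) (e : bool) (q q' a : nat) (p : int) (D : R)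
    : Prop := CfLevel {
  lev_q_gt0 : (0 < q)%N;
  lev_a_gt0 : (0 < a)%N;
  lev_q'_ge : (a * q <= q')%N;
  lev_q'_le : (q' <= a.+1 * q)%N;
  lev_D_gt : q'%:R < D;
  lev_D_le : D <= (q' + q)%:R;
  lev_alpha : alpha * q%:R = p%:~R + (-1) ^+ e / D;
  lev_coprime : coprimez p q;
  lev_odd : e -> (q%:Z %| p * q'%:Z - 1)%Z }.

(** * Denominators of convergents and the data of each level *)

Section Levels.
Variables (R : realType) (alpha : R).
Hypothesis alpha_irr : irrational alpha.
Local Notation q := (cf_den alpha).
Local Notation a := (fun k => `|pquot alpha k|%N).
Local Notation P := (continuant (pquot alpha) 0 1).
Local Notation Q := (continuant (pquot alpha) 1 0).

Let b_gt0 k : 0 < pquot alpha k.+1. Proof. exact: pquot_gt0. Qed.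

Lemma pquot_abs k : pquot alpha k.+1 = (a k.+1)%:Z.
Proof. by rewrite gtz0_abs. Qed.

Lemma cf_den_continuant k : (q k)%:Z = Q k.+2.
Proof. exact: denq_cf_value. Qed.

Lemma cf_den_gt0 k : (0 < q k)%N.
Proof.
by rewrite -ltz_nat cf_den_continuant; have [] := continuant_den_gt0 b_gt0 k.
Qed.

Lemma cf_den0 : q 0 = 1%N.
Proof.
by apply/eqP; rewrite -eqz_nat cf_den_continuant /continuant mulr0 add0r.
Qed.

Lemma cf_denSS k : q k.+2 = (a k.+2 * q k.+1 + q k)%N.
Proof.
apply/eqP; rewrite -eqz_nat PoszD PoszM !cf_den_continuant -pquot_abs.
by rewrite continuantSS.
Qed.

Lemma cf_den_le k : (q k <= q k.+1)%N.
Proof.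
have apos j : (0 < a j.+1)%N by rewrite absz_gt0 gt_eqF.
case: k => [|k]; first by rewrite cf_den0 cf_den_gt0.
by rewrite cf_denSS; have := apos k.+1; nia.
Qed.

(** With x the complete quotient of index k+1, D = x q_k + q_(k-1). Then alpha = (x p_k +
    p_(k-1))/D, so the determinant gives q_k alpha - p_k = (-1)^k/D, and a < x < a + 1 locates D. *)
Lemma cf_levelP k : exists p D,
  cf_level alpha (odd k) (q k) (q k.+1) (a k.+1) p D.
Proof.
have apos : (0 < a k.+1)%N by rewrite absz_gt0 gt_eqF.
have [Q2 Q1] := continuant_den_gt0 b_gt0 k.
have rec : Q k.+3 = (a k.+1)%:Z * Q k.+2 + Q k.+1 by rewrite continuantSS pquot_abs.
have Q12 : Q k.+1 <= Q k.+2.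
  case: (k) => [|j]; first by rewrite /continuant; lia.
  have [] := continuant_den_gt0 b_gt0 j.
  by rewrite (continuantSS _ _ _ j.+1); have := b_gt0 j; nia.
set x := complete_quot alpha k.+1.
have x1 : 1 < x by exact: complete_quot_gt1.
have xa : (a k.+1)%:R < x.
  have /andP[] := floor_itv x; rewrite -/(pquot alpha k.+1) {1}pquot_abs => + _.
  (* Equality would make the complete quotient an integer, against irrationality. *)
  rewrite le_eqVlt => /predU1P[E|//].
  case: (@irrational_complete_quot _ alpha k.+1 alpha_irr); exists (a k.+1)%:R => //.
  by rewrite ratr_nat -/x -E.
have xa1 : x < (a k.+1)%:R + 1.
  by have /andP[_] := floor_itv x; rewrite -/(pquot alpha k.+1) {1}pquot_abs rmorphD.
have QR0 : 0 < (Q k.+2)%:~R :> R by rewrite ltr0z.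
have QR1 : 0 <= (Q k.+1)%:~R :> R by rewrite ler0z.
pose D := x * (Q k.+2)%:~R + (Q k.+1)%:~R.
have D0 : 0 < D by rewrite ltr_wpDr// mulr_gt0//; lra.
have qR j : (q j)%:R = (Q j.+2)%:~R :> R by rewrite -cf_den_continuant.
exists (P k.+2), D; split.
- exact: cf_den_gt0.
- exact: apos.
- by rewrite -lez_nat PoszM !cf_den_continuant rec; lia.
- by rewrite -lez_nat PoszM !cf_den_continuant rec; nia.
- rewrite qR rec rmorphD rmorphM /D ltrD2r ltr_pM2r//.
- rewrite natrD !qR rec rmorphD rmorphM /D addrAC lerD2r.
  by rewrite /= -[X in _ <= _ + X]mul1r -mulrDl ler_wpM2r// ltW.
- rewrite {1}(@complete_quot_expansion _ alpha k.+1 alpha_irr).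
  rewrite foldr_continuant//; last first.
    by right; rewrite (lt_trans ltr01).
  rewrite -/x -/D qR.
  have det := continuant_det (pquot alpha) k.+1.
  have {}det : (P k.+2)%:~R * (Q k.+1)%:~R - (P k.+1)%:~R * (Q k.+2)%:~R
      = - (-1) ^+ k :> R.
    rewrite -!rmorphM -rmorphB det exprS rmorphM rmorphN rmorph1 mulN1r.
    by rewrite rmorphXn rmorphN rmorph1.
  have Dn : D != 0 by rewrite gt_eqF.
  rewrite signr_odd -[(-1) ^+ k]opprK -det.
  apply: (mulIf Dn); rewrite mulrAC divfK// [RHS]mulrDl divfK// /D; ring.
- by rewrite cf_den_continuant; exact: coprime_continuants.
(* For k odd the determinant is p_k q_(k-1) - p_(k-1) q_k = 1, and q_(k+1) is congruent to q_(k-1)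
   modulo q_k. *)
- move=> ok; rewrite !cf_den_continuant rec.
  have := continuant_det (pquot alpha) k.+1; rewrite exprS -signr_odd ok/=.
  rewrite expr1 mulrNN mulr1 => E.
  apply/dvdzP; exists (P k.+2 * (a k.+1)%:Z + P k.+1).
  by rewrite -[X in _ - X]E; ring.
Qed.

End Levels.

(** * One level of the expansion *)

Section SumTools.
Variable R : realType.
Implicit Types (f : nat -> R) (P : pred nat) (m n : nat).

Lemma ler_sum_nat_cond (P1 P2 : pred nat) f1 f2 m n :
  (forall i, (m <= i < n)%N ->
     (if P1 i then f1 i else 0) <= (if P2 i then f2 i else 0) :> R) ->
  \sum_(m <= i < n | P1 i) f1 i <= \sum_(m <= i < n | P2 i) f2 i.
Proof.
move=> H; rewrite big_mkcond [leRHS]big_mkcond [leLHS]big_nat_cond.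
by rewrite [leRHS]big_nat_cond; apply: ler_sum => i /andP[/H].
Qed.

Lemma ler_sum_nat f1 f2 m n : (forall i, (m <= i < n)%N -> f1 i <= f2 i) ->
  \sum_(m <= i < n) f1 i <= \sum_(m <= i < n) f2 i.
Proof. by move=> H; apply: ler_sum_nat_cond. Qed.

Lemma sum_nat_eq_le1 c d N :
  \sum_(1 <= n < N.+1) (n + c == d)%N%:R <= 1 :> R.
Proof.
suff H : \sum_(1 <= n < N.+1) (n + c == d)%N%:R <= (d <= N + c)%:R :> R.
  by apply: le_trans H _; case: (_ <= _)%N.
elim: N => [|N IH]; first by rewrite big_geq.
rewrite big_nat_recr//=; apply: le_trans (lerD IH (lexx _)) _.
rewrite -natrD ler_nat; lia.
Qed.

Lemma sum_dvdn q f N : (0 < q)%N ->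
  \sum_(1 <= n < N.+1 | (q %| n)%N) f n = \sum_(1 <= j < (N %/ q).+1) f (j * q)%N.
Proof.
move=> q0; elim: N => [|N IH]; first by rewrite div0n !big_geq.
rewrite big_mkcond big_nat_recr//= -big_mkcond/= IH.
case: ifPn => dv.
  have -> : (N.+1 %/ q = (N %/ q).+1)%N by rewrite divnS// dv.
  rewrite [RHS]big_nat_recr//=; congr (_ + f _).
  by rewrite -[LHS](divnK dv) divnS// dv.
by rewrite divnS// (negbTE dv) addr0.
Qed.

Lemma sum_nat_le_or P1 P2 P3 f m n :
  (forall i, (m <= i < n)%N -> 0 <= f i) ->
  (forall i, (m <= i < n)%N -> P1 i -> P2 i || P3 i) ->
  \sum_(m <= i < n | P1 i) f i <=
    \sum_(m <= i < n | P2 i) f i + \sum_(m <= i < n | P3 i) f i.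
Proof.
move=> f0 sub; rewrite big_mkcond [X in _ <= X + _]big_mkcond.
rewrite [X in _ <= _ + X]big_mkcond -big_split/=; apply: ler_sum_nat => i im.
have := f0 i im; have := sub i im; case: (P1 i) => [/(_ isT)|_].
  by case: (P2 i); case: (P3 i) => //= _ ?; rewrite ?addr0 ?add0r// lerDl.
by case: (P2 i); case: (P3 i) => //= ?; rewrite ?addr0 ?add0r// addr_ge0.
Qed.

Lemma sum_nat_le_sub P1 P2 f m n :
  (forall i, (m <= i < n)%N -> 0 <= f i) ->
  (forall i, (m <= i < n)%N -> P1 i -> P2 i) ->
  \sum_(m <= i < n | P1 i) f i <= \sum_(m <= i < n | P2 i) f i.
Proof.
move=> f0 sub; apply: le_trans (@sum_nat_le_or P1 P2 pred0 f m n f0 _) _.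
  by move=> i im /(sub i im) ->.
by rewrite big_pred0_eq addr0.
Qed.

Lemma sum_nat_le_widen P f m m' n : (m <= m' <= n)%N ->
  (forall i, (m <= i < n)%N -> 0 <= f i) ->
  \sum_(m' <= i < n | P i) f i <= \sum_(m <= i < n | P i) f i.
Proof.
move=> /andP[mm' m'n] f0; rewrite [leRHS](@big_cat_nat _ _ _ m')//= lerDr.
rewrite big_nat_cond; apply: sumr_ge0 => i /andP[/andP[mi im'] _]; apply: f0.
by rewrite mi (leq_trans im').
Qed.

Lemma sum_nat_ge0 P f m n : (forall i, (m <= i < n)%N -> 0 <= f i) ->
  0 <= \sum_(m <= i < n | P i) f i.
Proof.
by move=> f0; rewrite big_nat_cond; apply: sumr_ge0 => i /andP[/f0].
Qed.

End SumTools.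

(** Provides two consecutive dyadic blocks [m, 2m) and [2m, 4m) inside [1, B] that start above
    3(B+1)/16, where the cutoff will be satisfied. *)
Lemma dyadic_start B : (15 <= B)%N ->
  exists m, [/\ (0 < m)%N, (3 * B.+1 <= 16 * m)%N & (4 * m <= B.+1)%N].
Proof.
have := divn_eq (3 * B.+1) 16; have := ltn_pmod (3 * B.+1) (isT : 0 < 16)%N.
move: (_ %/ 16)%N (_ %% 16)%N => u v v16 E B15.
by exists u.+1; split; lia.
Qed.

(** * Residues and fractional parts at a single level *)

Section Level.
Variables (R : realType) (alpha : R) (e : bool) (q q' a : nat) (p : int) (D : R).
Hypothesis lev : cf_level alpha e q q' a p D.
Implicit Types (n N M B j : nat).

Local Notation F n := (fpart (n%:R * alpha)).

Lemma level_q_pos : 0 < q%:R :> R. Proof. by rewrite ltr0n (lev_q_gt0 lev). Qed.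

Lemma level_a_ge1 : 1 <= a%:R :> R. Proof. by rewrite ler1n (lev_a_gt0 lev). Qed.

Lemma level_D_pos : 0 < D.
Proof. by rewrite (le_lt_trans _ (lev_D_gt lev)). Qed.

Lemma level_D_bounds : a%:R * q%:R < D <= (a%:R + 2) * q%:R.
Proof.
apply/andP; split.
  by apply: le_lt_trans (lev_D_gt lev); rewrite -natrM ler_nat (lev_q'_ge lev).
apply: le_trans (lev_D_le lev) _; rewrite -natrD -natrM ler_nat.
by have := lev_q'_le lev; lia.
Qed.

Lemma level_D_le : D <= 3 * a%:R * q%:R.
Proof.
have /andP[_ Dhi] := level_D_bounds; apply: le_trans Dhi _.
have := level_a_ge1; rewrite ler_pM2r ?level_q_pos//; lra.
Qed.

Hint Resolve level_q_pos level_D_pos : core.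
Let q0 : (0 < q)%N := lev_q_gt0 lev.

(** At an odd level n alpha lies below n p/q; borrowing 1 from n p keeps the remaining shift 1 - n/D
    in (0, 1). *)
Definition level_res n : nat := `|((n%:Z * p - e%:Z) %% q%:Z)%Z|%N.
Definition level_shift n : R := if e then 1 - n%:R / D else n%:R / D.

Lemma level_resE n : (level_res n)%:Z = ((n%:Z * p - e%:Z) %% q%:Z)%Z.
Proof. by rewrite gez0_abs// modz_ge0// eqz_nat -lt0n. Qed.

Lemma level_res_lt n : (level_res n < q)%N.
Proof. by rewrite -ltz_nat level_resE ltz_pmod. Qed.

Lemma level_shift_itv n : (0 < n < q')%N -> 0 < level_shift n < 1.
Proof.
move=> /andP[n0 nq]; have nD : n%:R / D < 1.
  by rewrite ltr_pdivrMr// mul1r (lt_trans _ (lev_D_gt lev))// ltr_nat.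
have n0' : 0 < n%:R / D by rewrite divr_gt0// ltr0n.
by rewrite /level_shift; case: (e); apply/andP; split; lra.
Qed.

(** Residue plus shift is below q, so the integer quotient of n p - e by q is the floor of n
    alpha. *)
Lemma level_fpart n : (0 < n < q')%N ->
  F n = ((level_res n)%:R + level_shift n) / q%:R.
Proof.
move=> nq; set z := n%:Z * p - e%:Z.
have /andP[s0 s1] := level_shift_itv nq.
have E : n%:R * alpha = (z %/ q)%Z%:~R + ((level_res n)%:R + level_shift n) / q%:R.
  apply: (mulIf (lt0r_neq0 level_q_pos)).
  rewrite mulrDl divfK ?gt_eqF// -mulrA (lev_alpha lev).
  have -> : (level_res n)%:R = (z %% q)%Z%:~R :> R by rewrite -level_resE.
  have -> : (z %/ q)%Z%:~R * q%:R = ((z %/ q)%Z * q)%:~R :> R by rewrite rmorphM.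
  rewrite addrA -rmorphD -divz_eq /z rmorphB rmorphM /= /level_shift.
  rewrite -pmulrn; case: (e) => /=; rewrite ?expr1 ?expr0; by ring.
have b1 : 0 <= ((level_res n)%:R + level_shift n) / q%:R.
  by rewrite divr_ge0// addr_ge0// ltW.
have b2 : ((level_res n)%:R + level_shift n) / q%:R < 1.
  rewrite ltr_pdivrMr// mul1r.
  have : (level_res n).+1%:R <= q%:R :> R by rewrite ler_nat level_res_lt.
  by rewrite -natr1; lra.
have fl : Num.floor (n%:R * alpha) = (z %/ q)%Z.
  by apply: floor_def; rewrite rmorphD E; apply/andP; split; lra.
by rewrite /fpart fl E addrC addKr.
Qed.

Lemma level_res_inj n m : level_res n = level_res m -> (q%:Z %| n%:Z - m%:Z)%Z.
Proof.
move=> /(congr1 Posz); rewrite !level_resE => /eqP.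
rewrite eqz_mod_dvd => d.
rewrite -(@Gauss_dvdzr _ p) 1?coprimez_sym ?(lev_coprime lev)//.
by move: d; congr (_ %| _)%Z; ring.
Qed.

(** As p is prime to q, q consecutive integers have distinct residues, which therefore run through
    all of 0, ..., q - 1. *)
Lemma sum_block (phi : nat -> R) M :
  \sum_(M <= n < M + q) phi (level_res n) = \sum_(0 <= r < q) phi r.
Proof.
rewrite -{1}[M]add0n big_addn addKn !big_mkord.
pose h (i : 'I_q) := Ordinal (level_res_lt (i + M)).
have hinj : injective h.
  move=> i j /(congr1 val)/= /level_res_inj/dvdzP[z]; move: (ltn_ord i) (ltn_ord j).
  move=> iq jq zE; apply: val_inj => /=.
  have [z0|[z0|z0]] : z = 0 \/ z <= -1 \/ 1 <= z by lia.
  - by rewrite z0 in zE; lia.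
  - by nia.
  - by nia.
by rewrite [RHS](reindex_inj hinj).
Qed.

Lemma sum_blocks (phi : nat -> R) M B :
  \sum_(M <= n < M + B * q) phi (level_res n) = B%:R * \sum_(0 <= r < q) phi r.
Proof.
elim: B => [|B IH]; first by rewrite mul0n addn0 big_geq// mul0r.
rewrite mulSnr addnA (@big_cat_nat _ _ _ (M + B * q))/= ?leq_addr//.
by rewrite IH sum_block -natr1 mulrDl mul1r.
Qed.

Lemma sum_blocks_le (phi : nat -> R) N : (forall r, 0 <= phi r) ->
  \sum_(1 <= n < N.+1) phi (level_res n) <=
    (N %/ q).+1%:R * \sum_(0 <= r < q) phi r.
Proof.
move=> phi0; rewrite -(sum_blocks phi 1).
rewrite [leRHS](@big_cat_nat _ _ _ N.+1)//=; last first.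
  by rewrite add1n ltnS ltnW// ltn_ceil.
by rewrite lerDl sumr_ge0.
Qed.

Lemma level_fpart_gt0 n : (0 < n < q')%N -> 0 < F n.
Proof.
move=> nq; have /andP[s0 _] := level_shift_itv nq.
by rewrite level_fpart// divr_gt0// ltr_wpDl.
Qed.

Lemma level_fpart_inv n : (0 < n < q')%N ->
  (F n)^-1 = q%:R / ((level_res n)%:R + level_shift n).
Proof. by move=> nq; rewrite level_fpart// invf_div. Qed.

(** For residue r > 0 the term lies between q/(r+1) and q/r. Over a block these bounds sum to q(H_q
    - 1) and q H_(q-1), both q ln q + O(q). *)
Lemma level_nonzero_res M B : (M + B * q < q')%N ->
  `|\sum_(M.+1 <= n < (M + B * q).+1 | level_res n != 0%N) (F n)^-1
     - (B * q)%:R * ln q%:R| <= (B * q)%:R.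
Proof.
move=> Nq.
pose phi1 r : R := if r == 0%N then 0 else q%:R / r.+1%:R.
pose phi2 r : R := if r == 0%N then 0 else q%:R / r%:R.
have bnd n : (M.+1 <= n < (M + B * q).+1)%N ->
    phi1 (level_res n) <= (if level_res n != 0%N then (F n)^-1 else 0)
      <= phi2 (level_res n).
  move=> /andP[n1 n2]; rewrite /phi1 /phi2; case: eqVneq => /= r0; first by rewrite lexx.
  have nq : (0 < n < q')%N by apply/andP; split; lia.
  have rR : 0 < (level_res n)%:R :> R by rewrite ltr0n lt0n.
  have /andP[s0 s1] := level_shift_itv nq.
  rewrite level_fpart_inv// -natr1 !ler_pM2l// !lef_pV2 ?posrE; lra.
have E1 : \sum_(0 <= r < q) phi1 r = q%:R * (harmonic_sum R q - 1).
  rewrite /harmonic_sum big_ltn// [phi1 0]/phi1/= add0r [in RHS]big_ltn ?ltnS//.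
  rewrite invr1 addrAC subrr add0r mulr_sumr [RHS]big_add1/=.
  by apply: eq_big_nat => -[].
have E2 : \sum_(0 <= r < q) phi2 r = q%:R * harmonic_sum R q.-1.
  rewrite /harmonic_sum big_ltn// [phi2 0]/phi2/= add0r prednK// mulr_sumr.
  by apply: eq_big_nat => -[].
have S1 : (B * q)%:R * (harmonic_sum R q - 1) <=
    \sum_(M.+1 <= n < (M + B * q).+1 | level_res n != 0%N) (F n)^-1.
  rewrite natrM -mulrA -E1 -(sum_blocks phi1 M.+1) addSn [leRHS]big_mkcond.
  by apply: ler_sum_nat => n /bnd/andP[].
have S2 : \sum_(M.+1 <= n < (M + B * q).+1 | level_res n != 0%N) (F n)^-1 <=
    (B * q)%:R * harmonic_sum R q.-1.
  rewrite natrM -mulrA -E2 -(sum_blocks phi2 M.+1) addSn [leLHS]big_mkcond.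
  by apply: ler_sum_nat => n /bnd/andP[].
have h1 : ln q%:R <= harmonic_sum R q.
  by apply: le_trans (harmonic_sum_ge R q); rewrite ler_ln_nat.
have h2 : harmonic_sum R q.-1 <= 1 + ln q%:R.
  by apply: le_trans (harmonic_sum_le R _) _; rewrite lerD2l ler_ln_nat// leq_pred.
have x0 : 0 <= (B * q)%:R :> R by [].
rewrite ler_norml; apply/andP; split.
  by have := ler_wpM2l x0 h1; lra.
by have := ler_wpM2l x0 h2; lra.
Qed.

Lemma level_even_res n : ~~ e -> (level_res n == 0%N) = (q %| n)%N.
Proof.
move=> /negbTE ne; rewrite -eqz_nat level_resE ne subr0.
rewrite (sameP eqP dvdz_mod0P) mulrC Gauss_dvdzr//.
by rewrite coprimez_sym (lev_coprime lev).
Qed.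

Lemma level_even_fpart j : ~~ e -> (0 < j)%N -> (j * q < q')%N ->
  F (j * q)%N = j%:R / D.
Proof.
move=> ne j0 jq; rewrite level_fpart ?muln_gt0 ?j0 ?q0//.
have /eqP -> : level_res (j * q) == 0%N by rewrite level_even_res// dvdn_mull.
by rewrite /level_shift (negbTE ne) add0r natrM; field; rewrite !gt_eqF.
Qed.

(* For odd levels the residue vanishes exactly when n = q' - i q, and then
   1/{n alpha} <= D/i; as a - i <= n/q this is at most 3q + 3N/i. *)
Lemma level_odd_zero_res N : e -> (q <= N < q')%N ->
  \sum_(1 <= n < N.+1 | level_res n == 0%N) (F n)^-1 <=
    N%:R * (6 + 3 * harmonic_sum R a).
Proof.
move=> eT /andP[qN Nq'].
have NR : 0 < N%:R :> R by rewrite ltr0n (leq_trans q0).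
pose phi r : R := if r == 0%N then 3 * q%:R else 0.
(* The indicator spreads the unknown i over a full sum; after exchanging the sums, each i is met by
   at most one n. *)
apply: le_trans (_ : \sum_(1 <= n < N.+1) (phi (level_res n) +
    \sum_(1 <= i < a.+1) (3 * N%:R / i%:R) * (n + i * q == q')%N%:R) <= _).
  rewrite big_mkcond; apply: ler_sum_nat => n /andP[n1 nN].
  have t0 i : 0 <= (3 * N%:R / i%:R) * (n + i * q == q')%N%:R :> R.
    by rewrite !mulr_ge0 ?invr_ge0.
  rewrite /phi; case: eqVneq => r0; last by rewrite add0r sumr_ge0.
  have nq : (0 < n < q')%N by apply/andP; split; lia.
  have : (q%:Z %| q'%:Z - n%:Z)%Z.
    have d1 : (q%:Z %| n%:Z * p - 1)%Z.
      by have := level_resE n; rewrite r0 eT => /esym/dvdz_mod0P.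
    have d2 := lev_odd lev eT.
    rewrite -(@Gauss_dvdzr _ p) 1?coprimez_sym ?(lev_coprime lev)//.
    have -> : p * (q'%:Z - n%:Z) = (p * q'%:Z - 1) - (n%:Z * p - 1) by ring.
    by rewrite rpredB.
  move=> /dvdzP[z zE].
  have [i iE] : exists i : nat, z = i by exists `|z|%N; nia.
  have {zE}iE : (n + i * q = q')%N by rewrite iE in zE; lia.
  have i0 : (0 < i)%N by nia.
  have ia : (i <= a)%N by have := lev_q'_le lev; nia.
  have iR : 0 < i%:R :> R by rewrite ltr0n.
  rewrite (bigD1_seq i)/=; [|by rewrite mem_index_iota i0 ltnS|exact: iota_uniq].
  rewrite iE eqxx mulr1.
  apply: le_trans (_ : 3 * q%:R + 3 * N%:R / i%:R <= _); last first.
    by rewrite lerD2l lerDl sumr_ge0.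
  have qDi : D - n%:R >= i%:R * q%:R.
    by have := lev_D_gt lev; rewrite -iE natrD natrM; lra.
  have Dn0 : 0 < D - n%:R by apply: lt_le_trans qDi; rewrite mulr_gt0.
  have -> : (F n)^-1 = q%:R * D / (D - n%:R).
    rewrite level_fpart_inv// r0 add0r /level_shift eT.
    by field; rewrite !gt_eqF.
  apply: le_trans (_ : D / i%:R <= _).
    rewrite ler_pdivrMr// mulrAC ler_pdivlMr//.
    by have := ler_wpM2l (ltW level_D_pos) qDi; lra.
  rewrite ler_pdivrMr// mulrDl divfK ?gt_eqF//.
  have : a%:R * q%:R <= n%:R + i%:R * q%:R :> R.
    by rewrite -!natrM -natrD ler_nat iE (lev_q'_ge lev).
  have : n%:R <= N%:R :> R by rewrite ler_nat -ltnS.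
  by have := level_D_le; nra.
rewrite big_split/= exchange_big/=.
have S1 : \sum_(1 <= n < N.+1) phi (level_res n) <= 6 * N%:R.
  apply: le_trans (sum_blocks_le _ _) _.
    by move=> r; rewrite /phi; case: ifP; rewrite ?mulr_ge0.
  have -> : \sum_(0 <= r < q) phi r = 3 * q%:R.
    by rewrite big_ltn// [phi 0]/phi/= big_nat_cond big1 ?addr0// => -[].
  have : (N %/ q).+1%:R * q%:R <= 2 * N%:R :> R.
    rewrite -!natrM ler_nat mulSn; have := leq_trunc_div N q; lia.
  lra.
have S2 : \sum_(1 <= i < a.+1) \sum_(1 <= n < N.+1)
    (3 * N%:R / i%:R) * (n + i * q == q')%N%:R <= 3 * N%:R * harmonic_sum R a.
  rewrite /harmonic_sum mulr_sumr; apply: ler_sum_nat => i /andP[i1 _].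
  rewrite -mulr_sumr ler_piMr ?sum_nat_eq_le1// !mulr_ge0 ?invr_ge0//.
lra.
Qed.

(** Since N >= q, a term under the cutoff has residue r < c, so q/r <= c q/r^2, which is summable
    over residues. The 4 is 2 for the sum of 1/r^2 times 2 for rounding N/q up. *)
Lemma level_cutoff (c : R) N : 0 < c -> (q <= N < q')%N ->
  \sum_(1 <= n < N.+1 | (level_res n != 0%N) && (F n < c / N%:R)) (F n)^-1
    <= 4 * c * N%:R.
Proof.
move=> c0 /andP[qN Nq'].
have NR : 0 < N%:R :> R by rewrite ltr0n (leq_trans q0).
pose phi r : R := c * q%:R * (r%:R ^+ 2)^-1.
apply: le_trans (_ : \sum_(1 <= n < N.+1) phi (level_res n) <= _).
  rewrite big_mkcond; apply: ler_sum_nat => n /andP[n1 nN].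
  have phi0 : 0 <= phi (level_res n).
    by rewrite /phi !mulr_ge0 ?invr_ge0 ?exprn_ge0// ltW.
  case: ifPn => // /andP[r0 cut].
  have nq : (0 < n < q')%N by apply/andP; split; lia.
  have /andP[s0 s1] := level_shift_itv nq.
  have rR : 0 < (level_res n)%:R :> R by rewrite ltr0n lt0n.
  have F0 := level_fpart_gt0 nq.
  have rF : (level_res n)%:R / q%:R <= F n.
    by rewrite level_fpart// ler_pM2r ?invr_gt0//; lra.
  have rc : (level_res n)%:R < c.
    have : F n < c / q%:R.
      apply: lt_le_trans cut _; rewrite ler_pM2l// lef_pV2 ?posrE//.
      by rewrite ler_nat.
    by move=> /(le_lt_trans rF); rewrite ltr_pM2r// invr_gt0.
  apply: le_trans (_ : q%:R / (level_res n)%:R <= _).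
    by rewrite -invf_div lef_pV2// posrE divr_gt0.
  rewrite /phi; move: (level_res n)%:R rR rc => r r1 r2.
  rewrite expr2 invfM mulrA -(mulrA c) ler_pM2r ?invr_gt0// mulrCA.
  by rewrite ler_peMr ?ltW// ltr_pdivlMr// mul1r.
apply: le_trans (sum_blocks_le _ _) _.
  by move=> r; rewrite /phi !mulr_ge0 ?invr_ge0 ?exprn_ge0// ltW.
have -> : \sum_(0 <= r < q) phi r = c * q%:R * \sum_(1 <= r < q.-1.+1) (r%:R ^+ 2)^-1.
  rewrite mulr_sumr prednK// big_ltn//.
  by rewrite [phi 0]/phi expr0n/= invr0 mulr0 add0r.
have S := invsq_sum_le2 R q.-1; move: S; set S := \sum_(_ <= _ < _) _ => S2.
have : (N %/ q).+1%:R * q%:R <= 2 * N%:R :> R.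
  rewrite -!natrM ler_nat mulSn; have := leq_trunc_div N q; lia.
set y := _.+1%:R => yq.
apply: le_trans (_ : (y * q%:R) * (c * 2) <= _); last first.
  by have := ler_wpM2r (ltW c0) yq; lra.
rewrite [leLHS](_ : _ = (y * q%:R) * (c * S)); last by ring.
by rewrite ler_wpM2l ?mulr_ge0// ler_pM2l.
Qed.

Lemma level_even_sum_le B : (B <= a)%N ->
  \sum_(1 <= j < B.+1) D / j%:R <= 3 * q'%:R * harmonic_sum R a.
Proof.
move=> Ba; rewrite -mulr_sumr; apply: ler_pM => //.
- by rewrite ltW.
- by apply: sumr_ge0 => i _; rewrite invr_ge0.
- apply: le_trans level_D_le _; rewrite -mulrA ler_pM2l// -natrM ler_nat.
  exact: lev_q'_ge lev.
rewrite /harmonic_sum [leRHS](@big_cat_nat _ _ _ B.+1)//= lerDl.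
by apply: sumr_ge0 => i _; rewrite invr_ge0.
Qed.

Lemma level_quot_le N : (N < q')%N -> (N %/ q <= a)%N.
Proof.
move=> Nq; rewrite -ltnS ltn_divLR//; exact: leq_trans (lev_q'_le lev).
Qed.

(** Split at j = sqrt a. Below it there are at most sqrt a terms, each at most N/c by the cutoff;
    above it at most N/q terms, each at most D/sqrt a <= 3 q sqrt a. *)
Lemma level_even_cutoff_le (c : R) N : 0 < c -> (q <= N < q')%N ->
  \sum_(1 <= j < (N %/ q).+1 | c / N%:R <= j%:R / D) D / j%:R
    <= (c^-1 + 3) * (Num.sqrt a%:R * N%:R).
Proof.
move=> c0 /andP[qN Nq'].
have NR : 0 < N%:R :> R by rewrite ltr0n (leq_trans q0).
have s0 : 0 < Num.sqrt a%:R :> R by rewrite sqrtr_gt0 ltr0n (lev_a_gt0 lev).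
have ss : Num.sqrt a%:R * Num.sqrt a%:R = a%:R :> R by rewrite -expr2 sqr_sqrtr.
move: (Num.sqrt a%:R) s0 ss => s s0 ss.
have BN : (N %/ q)%:R * q%:R <= N%:R :> R by rewrite -natrM ler_nat leq_trunc_div.
set B := (N %/ q)%N in BN *.
apply: le_trans (_ : \sum_(1 <= j < B.+1 | j%:R <= s) N%:R / c +
   \sum_(1 <= j < B.+1) D / s <= _).
  rewrite big_mkcond [X in X + _]big_mkcond -big_split/=.
  apply: ler_sum_nat => j /andP[j1 jB].
  have jR : 0 < j%:R :> R by rewrite ltr0n.
  have Ds : 0 < D / s by rewrite divr_gt0.
  have Nc : 0 < N%:R / c by rewrite divr_gt0.
  have Dj : 0 < D / j%:R by rewrite divr_gt0.
  case: (ifPn (j%:R <= s)) => [js|]; last first.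
    rewrite -ltNge => js; rewrite add0r; case: ifP => _; last exact: ltW.
    by rewrite ler_pM2l// lef_pV2 ?posrE// ltW.
  case: ifPn => cut; last by rewrite addr_ge0 ?ltW.
  apply: le_trans (_ : N%:R / c <= _); last by rewrite lerDl ltW.
  by rewrite -[leLHS]invf_div -[leRHS]invf_div lef_pV2 ?posrE ?divr_gt0.
have js_le : \sum_(1 <= j < B.+1 | j%:R <= s) N%:R / c <= s * (N%:R / c).
  rewrite -big_filter big_const_seq count_predT iter_addr_0 -[leLHS]mulr_natl.
  rewrite ler_pM2r ?divr_gt0//.
  have : (size [seq i <- index_iota 1 B.+1 | (i%:R <= s)%R] <= Num.truncn s)%N.
    apply: leq_trans (_ : size (index_iota 1 (Num.truncn s).+1) <= _)%N; last first.
      by rewrite size_iota subn1.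
    apply: uniq_leq_size; first by rewrite filter_uniq// iota_uniq.
    move=> i; rewrite mem_filter !mem_index_iota => /andP[si /andP[-> _]] /=.
    by rewrite ltnS truncn_ge_nat// ltW.
  rewrite -(ler_nat R) => /le_trans; apply.
  by rewrite truncn_le ltW.
have sum_le : \sum_(1 <= j < B.+1) D / s <= 3 * s * N%:R.
  rewrite sumr_const_nat subn1/= -[leLHS]mulr_natr.
  have : D / s <= 3 * s * q%:R.
    by rewrite ler_pdivrMr// mulrAC -(mulrA 3) ss level_D_le.
  move=> /(ler_wpM2r (ler0n R B)) /le_trans; apply.
  by rewrite -[leLHS]mulrA (mulrC q%:R) ler_pM2l ?mulr_gt0.
lra.
Qed.

(* Either the term j = 1 survives the cutoff, or D <= 3 N / c, or the terms with
   m <= j < 4 m survive for a suitable m and contribute at least D/2 + D/2. *)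
Lemma level_even_cutoff_ge (c : R) N : 0 < c -> (q <= N < q')%N ->
  4 * Num.sqrt (c * a%:R) * q%:R <= N%:R ->
  q'%:R - 3 / c * N%:R <=
    \sum_(1 <= j < (N %/ q).+1 | c / N%:R <= j%:R / D) D / j%:R.
Proof.
move=> c0 /andP[qN Nq'] hyp.
have D0 := level_D_pos; have q0R := level_q_pos.
have NR : 0 < N%:R :> R by rewrite ltr0n (leq_trans q0).
have B0 : (0 < N %/ q)%N by rewrite divn_gt0.
have NB : N%:R < (N %/ q).+1%:R * q%:R :> R by rewrite -natrM ltr_nat ltn_ceil.
set B := (N %/ q)%N in B0 NB *.
have terms0 j : 0 <= D / j%:R by rewrite divr_ge0// ltW.
have sum0 : 0 <= \sum_(1 <= j < B.+1 | c / N%:R <= j%:R / D) D / j%:R.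
  by apply: sumr_ge0.
have Nc : 0 <= 3 / c * N%:R by rewrite !mulr_ge0 ?invr_ge0// ltW.
have q'D := lev_D_gt lev.
case: (leP (c / N%:R) (1 / D)) => [x1|x1].
  rewrite big_mkcond big_ltn ?ltnS//= x1 divr1.
  have : 0 <= \sum_(2 <= j < B.+1) (if c / N%:R <= j%:R / D then D / j%:R else 0).
    by apply: sumr_ge0 => j _; case: ifP.
  lra.
(* From c D <= 3 c a q, the squared hypothesis 16 c a q^2 <= N^2, and N < (B+1) q. *)
have cDN : c * D <= 3 / 16 * N%:R * (B.+1)%:R.
  have sq : 16 * (c * a%:R) * q%:R ^+ 2 <= N%:R ^+ 2.
    have : (4 * Num.sqrt (c * a%:R) * q%:R) ^+ 2 <= N%:R ^+ 2.
      by rewrite ler_pXn2r// nnegrE ?mulr_ge0 ?sqrtr_ge0// ltW.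
    rewrite !exprMn sqr_sqrtr; last by rewrite mulr_ge0 ?(ltW c0).
    by move: (q%:R ^+ 2) (N%:R ^+ 2) => u v; lra.
  have h1 : c * D <= 3 * (c * a%:R) * q%:R.
    by have := ler_wpM2l (ltW c0) level_D_le; lra.
  rewrite -(ler_pM2r q0R); have := ler_wpM2r (ltW q0R) h1.
  have := ler_wpM2l (ltW NR) (ltW NB).
  move: sq; rewrite !expr2; move: (B.+1)%:R => y; nra.
clearbody B; case: (leqP 15 B) => B15; last first.
  have : D <= 3 / c * N%:R.
    rewrite -(ler_pM2l c0) mulrA [c * (3 / c)]mulrCA mulfV ?gt_eqF// mulr1.
    apply: le_trans cDN _.
    have : B.+1%:R <= 16 :> R by rewrite ler_nat ltnW.
    by move: B.+1%:R => y; nra.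
  lra.
have [m [m0 m1 m2]] := dyadic_start B15.
(* The block [k, 2k) has k terms, each at least D/(2k); all pass the cutoff because j >= m >=
   3(B+1)/16. *)
have half k : (m <= k)%N -> (2 * k <= B.+1)%N ->
    D / 2 <= \sum_(k <= j < 2 * k) (if c / N%:R <= j%:R / D then D / j%:R else 0).
  move=> mk kB; have k0 : (0 < k)%N by exact: leq_trans mk.
  have kR : 0 < k%:R :> R by rewrite ltr0n.
  have -> : D / 2 = \sum_(k <= j < 2 * k) D / (2 * k%:R).
    rewrite sumr_const_nat mul2n -addnn addnK -mulr_natr; field; exact: lt0r_neq0.
  apply: ler_sum_nat => j /andP[j1 j2].
  have jR : 0 < j%:R :> R by rewrite ltr0n (leq_trans k0).
  rewrite ifT.
    by rewrite ler_pM2l// lef_pV2 ?posrE ?mulr_gt0// -natrM ler_nat ltnW.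
  rewrite ler_pdivlMr// mulrAC ler_pdivrMr//; apply: le_trans cDN _.
  have : 3 * B.+1%:R <= 16 * j%:R :> R.
    by rewrite -!natrM ler_nat (leq_trans m1)// leq_mul2l (leq_trans mk).
  by rewrite [3 / 16 * _]mulrC -mulrA (mulrC j%:R) ler_pM2l//; lra.
have [le1 le2 le3 le4 le5] : [/\ m <= B.+1, 2 * m <= B.+1, m <= 2 * m,
    2 * m <= 2 * (2 * m) & 2 * (2 * m) <= B.+1]%N.
  by move: m2; clear => m2; split; lia.
rewrite big_mkcond (@big_cat_nat _ _ _ m)//=.
rewrite [X in _ <= _ + X](@big_cat_nat _ _ _ (2 * m)%N)//=.
rewrite [X in _ <= _ + (_ + X)](@big_cat_nat _ _ _ (2 * (2 * m))%N)//=.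
have [h1 h2] := (half m (leqnn _), half (2 * m)%N).
have := h1 le2; have := h2 le3 le5.
have pos u v : 0 <= \sum_(u <= j < v) (if c / N%:R <= j%:R / D then D / j%:R else 0).
  by apply: sumr_ge0 => j _; case: ifP.
have := pos 1%N m; have := pos (2 * (2 * m))%N B.+1.
lra.
Qed.

(** D/q lies between a and a + 2, and the sum of 1/j^2 is at most 2. *)
Lemma level_even_weighted N :
  `|\sum_(1 <= j < (N %/ q).+1) D / j%:R / (j * q)%:R - a%:R * invsq_sum R (N %/ q)|
    <= 4.
Proof.
have q0R := level_q_pos; set B := (N %/ q)%N.
have -> : \sum_(1 <= j < B.+1) D / j%:R / (j * q)%:R = D / q%:R * invsq_sum R B.
  rewrite /invsq_sum mulr_sumr; apply: eq_bigr => j _.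
  by rewrite natrM expr2 !invfM; ring.
have /andP[lo hi] := level_D_bounds.
have S0 : 0 <= invsq_sum R B by apply: sumr_ge0 => i _; rewrite invr_ge0 exprn_ge0.
have S2 : invsq_sum R B <= 2 by exact: invsq_sum_le2.
have : a%:R <= D / q%:R by rewrite ler_pdivlMr// ltW.
have : D / q%:R <= a%:R + 2 by rewrite ler_pdivrMr.
rewrite -mulrBl; move: (D / _) => x x1 x2.
rewrite ler_norml; apply/andP; split; nra.
Qed.

(** A complete level has at least a - 1 terms, so replacing its sum of 1/j^2 by pi^2/6 costs at most
    a * 20/a; 24 = 20 + 4. *)
Lemma level_even_weighted_full :
  `|\sum_(1 <= j < (q'.-1 %/ q).+1) D / j%:R / (j * q)%:R - a%:R * (pi ^+ 2 / 6)|
    <= 24.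
Proof.
have := @level_even_weighted q'.-1.
have := basel_bound R (q'.-1 %/ q); set B := (_ %/ _)%N.
have aB : a%:R <= B.+1%:R :> R.
  rewrite ler_nat -(leq_subLR a 1) leq_divRL//.
  by have := lev_q'_ge lev; have := lev_a_gt0 lev; nia.
have tail : a%:R * (20 / B.+1%:R) <= 20 :> R.
  by rewrite mulrA ler_pdivrMr ?ltr0n// mulrC ler_pM2l.
have a1 := level_a_ge1; move: (invsq_sum R B) (pi ^+ 2 / 6) => S z.
rewrite ler_norml => /andP[b1 b2]; rewrite ler_norml => /andP[b3 b4].
have := ler_wpM2l (le_trans ler01 a1) b1; have := ler_wpM2l (le_trans ler01 a1) b2.
move: b3 b4 tail; rewrite mulrN; move: (_ / B.+1%:R) (\sum_(_ <= _ < _) _) => t u.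
by move=> *; rewrite ler_norml; apply/andP; split; lra.
Qed.

End Level.

(** * Summation over all levels *)

(* The n of residue 0 at an even level k, where {n alpha} = |q_k alpha - p_k| n / q_k. *)
Definition special (R : realType) (alpha : R) (n : nat) : bool :=
  `[< exists k, [/\ ~~ odd k, (cf_den alpha k <= n < cf_den alpha k.+1)%N &
                    (cf_den alpha k %| n)%N] >].

Section Main.
Variables (R : realType) (alpha : R).
Hypothesis alpha_irr : irrational alpha.
Local Notation q := (cf_den alpha).
Local Notation a := (fun k => `|pquot alpha k|%N).
Local Notation F n := (fpart (n%:R * alpha)).
Local Notation sp := (special alpha).
Implicit Types (k K n N M : nat) (L : R).

Lemma pquot_natr k : (pquot alpha k.+1)%:~R = (a k.+1)%:R :> R.
Proof. by rewrite {1}pquot_abs. Qed.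

Lemma cf_den_homo k j : (k <= j)%N -> (q k <= q j)%N.
Proof.
move=> /subnKC <-; elim: (j - k)%N => [|i IH]; first by rewrite addn0.
by rewrite addnS (leq_trans IH)// cf_den_le.
Qed.

Lemma cf_level_uniq k K n : (q k <= n < q k.+1)%N -> (q K <= n < q K.+1)%N -> k = K.
Proof.
move=> /andP[k1 k2] /andP[K1 K2]; case: (ltngtP k K) => // /cf_den_homo H.
  by have := leq_ltn_trans K1 (leq_trans k2 H); rewrite ltnn.
by have := leq_ltn_trans k1 (leq_trans K2 H); rewrite ltnn.
Qed.

Lemma special_at K n : (q K <= n < q K.+1)%N -> sp n = ~~ odd K && (q K %| n)%N.
Proof.
move=> Kn; apply/asboolP/andP => [[k [ok kn dv]]|[oK dv]]; last by exists K.
by rewrite -(cf_level_uniq kn Kn).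
Qed.

Lemma cf_level_exists K M : (0 < M)%N -> (M < q K)%N ->
  exists2 k, (k < K)%N & (q k <= M < q k.+1)%N.
Proof.
move=> M0; elim: K => [|K IH] MK.
  by rewrite cf_den0// ltnS leqNgt M0 in MK.
have [MqK|MqK] := ltnP M (q K); last by exists K; rewrite ?MqK.
by have [k kK kM] := IH MqK; exists k; rewrite // ltnW.
Qed.

Lemma fpartV_ge0 n : 0 <= (F n)^-1.
Proof. by rewrite invr_ge0 fpart_ge0. Qed.

Lemma sum_special_level K N (f : nat -> R) : (N < q K.+1)%N ->
  \sum_(q K <= n < N.+1 | sp n) f n =
    if odd K then 0 else \sum_(1 <= j < (N %/ q K).+1) f (j * q K)%N.
Proof.
move=> NK; have q0 := cf_den_gt0 alpha_irr K.
have [NqK|qKN] := ltnP N (q K).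
  by rewrite big_geq// divn_small// big_geq//; case: ifP.
rewrite big_nat_cond.
rewrite (eq_bigl (fun n => (q K <= n < N.+1)%N &&
  (~~ odd K && (q K %| n)%N))); last first.
  move=> n; case: (boolP (q K <= n < N.+1)%N) => //= /andP[n1 n2].
  by rewrite (special_at (K := K))// n1 (leq_ltn_trans _ NK).
rewrite -big_nat_cond; case: (odd K) => /=; first by rewrite big_pred0_eq.
rewrite -sum_dvdn// [RHS](@big_cat_nat _ _ _ (q K))//= ?leqW//.
rewrite [X in _ = X + _]big_nat_cond [X in _ = X + _]big_pred0 ?add0r// => n.
apply/negP => /andP[/andP[n0 nK] dv].
by have := dvdn_leq n0 dv; rewrite leqNgt nK.
Qed.

(** An abstract L, valid for all levels up to K, lets the estimates descend to lower levels without
    changing constants. *)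
Definition cf_log_bound K L := forall k, (k <= K)%N -> 1 + ln (a k.+1)%:R <= L.

Lemma cf_log_boundW k K L : (k <= K)%N -> cf_log_bound K L -> cf_log_bound k L.
Proof. by move=> kK h j jk; apply: h; exact: leq_trans kK. Qed.

Lemma cf_log_bound_ge1 K L : cf_log_bound K L -> 1 <= L.
Proof. by move=> /(_ 0%N isT); have := ln_nat_ge0 R (a 1); lra. Qed.

(** Level k contributes at most 3 L q_(k+1), and the denominators grow fast enough for the last one
    to dominate the total. *)
Lemma special_below K L : cf_log_bound K L ->
  \sum_(1 <= n < q K | sp n) (F n)^-1 <= 9 * L * (q K)%:R.
Proof.
move=> hL; have L1 := cf_log_bound_ge1 hL.
case: K hL => [|K] hL.
  by rewrite cf_den0// big_geq// mulr_ge0//; lra.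
(* This form is stable under induction because q_(K+2) >= q_(K+1) + q_K. *)
suff : \sum_(1 <= n < q K.+1 | sp n) (F n)^-1 <= 3 * L * (2 * (q K.+1)%:R + (q K)%:R).
  have : (q K)%:R <= (q K.+1)%:R :> R by rewrite ler_nat cf_den_le.
  move: (q K)%:R (q K.+1)%:R => x y xy H; apply: le_trans H _; nra.
have step k : (k <= K.+1)%N ->
    \sum_(q k <= n < q k.+1 | sp n) (F n)^-1 <= 3 * L * (q k.+1)%:R.
  move=> kK; have q'0 := cf_den_gt0 alpha_irr k.+1.
  rewrite -(prednK q'0) sum_special_level ?prednK//.
  case: ifPn => ok; first by rewrite !mulr_ge0//; lra.
  have [p [D lev]] := cf_levelP alpha_irr k.
  apply: le_trans (_ : \sum_(1 <= j < ((q k.+1).-1 %/ q k).+1) D / j%:R <= _).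
    apply: ler_sum_nat => j /andP[j1 jB].
    rewrite (level_even_fpart lev)// ?invf_div//.
    by rewrite -(prednK q'0) ltnS -leq_divRL ?cf_den_gt0.
  apply: le_trans (level_even_sum_le lev _) _.
    by rewrite (level_quot_le lev)// prednK.
  rewrite mulrAC ler_wpM2r// ler_wpM2l//.
  exact: le_trans (harmonic_sum_le R _) (hL k kK).
elim: K hL step => [|K IH] hL step.
  rewrite (@big_cat_nat _ _ _ (q 0))//= ?cf_den_le ?cf_den0// big_geq// add0r.
  have := step 0%N isT; rewrite cf_den0// => H; apply: le_trans H _.
  have : 0 <= (q 1)%:R :> R by [].
  by move: (q 1)%:R => x x0; nra.
rewrite (@big_cat_nat _ _ _ (q K.+1))//= ?cf_den_le ?cf_den_gt0//.
have H1 : \sum_(1 <= n < q K.+1 | sp n) (F n)^-1 <= 3 * L * (2 * (q K.+1)%:R + (q K)%:R).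
  apply: IH => [|k kK]; first exact: cf_log_boundW hL.
  by apply: step; rewrite leqW.
have := step K.+1 (leqW (leqnn _)).
have : (q K.+1)%:R + (q K)%:R <= (q K.+2)%:R :> R.
  rewrite -natrD ler_nat cf_denSS// leq_add2r leq_pmull//.
  by rewrite absz_gt0 gt_eqF// pquot_gt0.
move: H1; move: (q K.+2)%:R (q K.+1)%:R (q K)%:R => x y z; nra.
Qed.

(** * Sum over the non-special integers *)

Definition regular_sum N : R := \sum_(1 <= n < N.+1 | ~~ sp n) (F n)^-1.

(** Having [odd K] in the filter gives one bound for both parities: the sum is empty at even levels.
    At odd levels 6 + 3 L <= 9 L. *)
Lemma odd_zero_res_bound K N L p D :
  cf_level alpha (odd K) (q K) (q K.+1) (a K.+1) p D ->
  (q K <= N < q K.+1)%N -> cf_log_bound K L ->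
  \sum_(1 <= n < N.+1 | odd K && (level_res (odd K) (q K) p n == 0%N)) (F n)^-1
    <= 9 * L * N%:R.
Proof.
move=> lev NK hL; have L1 := cf_log_bound_ge1 hL.
case oK: (odd K) in lev * => /=; last first.
  by rewrite big_pred0_eq !mulr_ge0//; lra.
apply: le_trans (level_odd_zero_res lev isT NK) _.
rewrite mulrC ler_wpM2r//.
have := le_trans (harmonic_sum_le R _) (hL K (leqnn _)); lra.
Qed.

Lemma not_special_zero_res K p D n :
  cf_level alpha (odd K) (q K) (q K.+1) (a K.+1) p D ->
  (0 < n < q K.+1)%N -> ~~ sp n -> level_res (odd K) (q K) p n == 0%N -> odd K.
Proof.
move=> lev /andP[n0 nK] ns r0; apply: contraNT ns => oK.
move: r0; rewrite (level_even_res lev)// => dv.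
by rewrite (special_at (K := K)) ?oK ?dv// nK dvdn_leq.
Qed.

(** With N = b + M, M the remainder, the expression is b(ln N - ln q) + M(ln N - ln M). The first
    part is at most b L because N <= (a+1) q, the second at most N because ln x <= x at x = N/M. *)
Lemma ln_split_bounds K N L : (q K <= N < q K.+1)%N -> cf_log_bound K L ->
  0 <= (N%:R * ln N%:R : R) - (N %% q K)%:R * ln (N %% q K)%:R
       - (N %/ q K * q K)%:R * ln (q K)%:R <= 2 * L * N%:R.
Proof.
move=> /andP[qN NK] hL; have L1 := cf_log_bound_ge1 hL.
have q0 := cf_den_gt0 alpha_irr K.
have [p [D lev]] := cf_levelP alpha_irr K.
have NE : N%:R = (N %/ q K * q K)%:R + (N %% q K)%:R :> R.
  by rewrite -natrD -divn_eq.
have t1 : ln (q K)%:R <= ln N%:R :> R by rewrite ler_ln_nat.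
have t2 : ln N%:R <= ln (q K)%:R + L.
  have aN : (N <= (a K.+1).+1 * q K)%N.
    by apply: leq_trans (lev_q'_le lev); exact: ltnW.
  have a0 := lev_a_gt0 lev.
  apply: le_trans (ler_ln_nat R aN) _; rewrite natrM lnM ?posrE ?ltr0n//.
  have [_ /= h1] := ln_natS_bounds R a0.
  have h2 : (a K.+1)%:R^-1 <= 1 :> R by rewrite invf_le1 ?ler1n ?ltr0n.
  have := hL K (leqnn _); lra.
have t3 : 0 <= ((N %% q K)%:R * (ln N%:R - ln (N %% q K)%:R) : R) <= N%:R.
  have [->|M0] := posnP (N %% q K)%N; first by rewrite mul0r lexx ler0n.
  have MR : 0 < (N %% q K)%:R :> R by rewrite ltr0n.
  have NR : 0 < N%:R :> R by rewrite ltr0n (leq_trans q0).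
  have MN : (N %% q K <= N)%N by exact: leq_mod.
  rewrite mulr_ge0 ?subr_ge0 ?ler_ln_nat//= -ln_div ?posrE// mulrC -ler_pdivlMr//.
  by apply: ltW; apply: ln_sublinear; rewrite divr_gt0.
have N0 : 0 <= N%:R :> R by [].
have M0 : 0 <= (N %% q K)%:R :> R by [].
have b0 : 0 <= (N %/ q K * q K)%:R :> R by [].
move: NE t1 t2 t3 M0 b0.
move: (N %/ q K * q K)%:R (N %% q K)%:R => b m NE t1 t2 /andP[t3 t4] m0 b0.
have -> : N%:R * ln N%:R - m * ln m - b * ln (q K)%:R =
   b * (ln N%:R - ln (q K)%:R) + m * (ln N%:R - ln m) by rewrite {1}NE; ring.
have s1 : 0 <= b * (ln N%:R - ln (q K)%:R) by rewrite mulr_ge0//; lra.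
have s2 : b * (ln N%:R - ln (q K)%:R) <= b * L by rewrite ler_wpM2l//; lra.
apply/andP; split; first lra.
have : b * L <= N%:R * L by rewrite ler_wpM2r//; lra.
have : N%:R <= N%:R * L by rewrite ler_peMr.
lra.
Qed.

(* The blocks of length q_K filling (N mod q_K, N] contribute q_K ln q_K + O(q_K) each. *)
Lemma regular_sum_step K N L : (q K <= N < q K.+1)%N -> cf_log_bound K L ->
  `|regular_sum N - N%:R * ln N%:R| <=
    `|regular_sum (N %% q K) - (N %% q K)%:R * ln (N %% q K)%:R| + 12 * L * N%:R.
Proof.
move=> NK hL; have /andP[qN Nq'] := NK; have L1 := cf_log_bound_ge1 hL.
have [p [D lev]] := cf_levelP alpha_irr K.
have /andP[ln0' ln2] := ln_split_bounds NK hL.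
set M := (N %% q K)%N in ln0' ln2 *; set b := (N %/ q K * q K)%N in ln0' ln2 *.
have NE : N = (M + b)%N by rewrite addnC -divn_eq.
have MN : (M <= N)%N by rewrite NE leq_addr.
pose res := level_res (odd K) (q K) p.
pose E := \sum_(M.+1 <= n < N.+1 | ~~ sp n) (F n)^-1.
pose S := \sum_(M.+1 <= n < N.+1 | res n != 0%N) (F n)^-1.
have GE : regular_sum N = regular_sum M + E.
  by rewrite /regular_sum (@big_cat_nat _ _ _ M.+1).
have hS : `|S - b%:R * ln (q K)%:R| <= b%:R.
  by have := level_nonzero_res lev (M := M) (B := N %/ q K); rewrite -/b -NE; exact.
have f0 n : (M.+1 <= n < N.+1)%N -> 0 <= (F n)^-1 by move=> _; exact: fpartV_ge0.
have f1 n : (1 <= n < N.+1)%N -> 0 <= (F n)^-1 by move=> _; exact: fpartV_ge0.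
have up : E <= S + 9 * L * N%:R.
  apply: le_trans (@sum_nat_le_or R _ (fun n => res n != 0%N)
    (fun n => odd K && (res n == 0%N)) _ _ _ f0 _) _.
    move=> n /andP[n1 n2] ns; case: eqVneq => //= r0; rewrite andbT.
    apply: (not_special_zero_res lev) ns _; last by rewrite -/res r0.
    by rewrite (leq_ltn_trans _ n1)// (leq_ltn_trans _ Nq').
  rewrite lerD2l; apply: le_trans (odd_zero_res_bound lev NK hL).
  by apply: sum_nat_le_widen => //; rewrite ltnS.
(* A special n of nonzero residue is not special at level K, so it lies below q_K. *)
have lo : S <= E + 9 * L * (q K)%:R.
  apply: le_trans (@sum_nat_le_or R _ (fun n => ~~ sp n)
    (fun n => sp n && (n < q K)%N) _ _ _ f0 _) _.
    move=> n /andP[n1 n2] rn; case: (boolP (sp n)) => //= sn.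
    rewrite ltnNge; apply/negP => qn; move: sn rn; rewrite (special_at (K := K)).
      by move=> /andP[oK]; rewrite -(level_even_res lev _ oK) -/(res n) => ->.
    by rewrite qn (leq_ltn_trans _ Nq').
  rewrite lerD2l; apply: le_trans (special_below hL).
  apply: le_trans (sum_nat_le_widen _ _ f1) _; first by rewrite ltnS.
  rewrite [leRHS](@big_nat_widen _ _ _ _ _ N.+1) ?leqW//.
have qNR : (q K)%:R <= N%:R :> R by rewrite ler_nat.
have bN : b%:R <= N%:R :> R by rewrite ler_nat NE leq_addl.
have N0 : 0 <= N%:R :> R by [].
have NL : N%:R <= N%:R * L by rewrite ler_peMr.
have qL : (q K)%:R * L <= N%:R * L by rewrite ler_wpM2r//; lra.
rewrite GE; move: hS; rewrite ler_norml => /andP[hS1 hS2].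
have -> : regular_sum M + E - N%:R * ln N%:R =
  (regular_sum M - M%:R * ln M%:R) +
  ((E - b%:R * ln (q K)%:R)
    - (N%:R * ln N%:R - M%:R * ln M%:R - b%:R * ln (q K)%:R)) by ring.
apply: le_trans (ler_normD _ _) _; rewrite lerD2l ler_norml.
move: ln0' ln2; set t := _ - b%:R * _ => t0 t2.
by apply/andP; split; lra.
Qed.

(** Strong induction: the remainder M satisfies 2 M <= N, so the errors 12 L N of successive steps
    form a geometric series of sum 24 L N. *)
Lemma regular_sum_bound K N L : (q K <= N < q K.+1)%N -> cf_log_bound K L ->
  `|regular_sum N - N%:R * ln N%:R| <= 24 * L * N%:R.
Proof.
elim/ltn_ind: N K => N IH K NK hL; have L1 := cf_log_bound_ge1 hL.
apply: le_trans (regular_sum_step NK hL) _.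
have /andP[qN Nq'] := NK; have q0 := cf_den_gt0 alpha_irr K.
have Mq : (N %% q K < q K)%N by rewrite ltn_pmod.
have MN : (2 * (N %% q K) <= N)%N.
  have := divn_eq N (q K); have : (0 < N %/ q K)%N by rewrite divn_gt0.
  by move: Mq; move: (N %/ q K)%N (N %% q K)%N => u v vq u0 ->; nia.
suff : `|regular_sum (N %% q K) - (N %% q K)%:R * ln (N %% q K)%:R| <=
    24 * L * (N %% q K)%:R.
  have : 2 * (N %% q K)%:R <= N%:R :> R by rewrite -natrM ler_nat.
  move: (N %% q K)%:R `|_| => m u h1 h2.
  have : 12 * L * (2 * m) <= 12 * L * N%:R by rewrite ler_wpM2l//; lra.
  lra.
have [->|M0] := posnP (N %% q K)%N.
  by rewrite /regular_sum big_geq// !mul0r mulr0 subr0 normr0.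
have [k kK kM] := cf_level_exists M0 Mq.
apply: (IH _ _ k) => //; first exact: leq_trans Mq qN.
by apply: cf_log_boundW hL; exact: ltnW.
Qed.

(** * The unweighted sum with cutoff *)

Lemma recip_sum_split (c : R) N :
  recip_sum c alpha N = regular_sum N
    - \sum_(1 <= n < N.+1 | ~~ sp n && (F n < c / N%:R)) (F n)^-1
    + \sum_(1 <= n < N.+1 | sp n && (c / N%:R <= F n)) (F n)^-1.
Proof.
rewrite /recip_sum /regular_sum (bigID sp)/= addrC; congr (_ + _).
  rewrite [X in _ = X - _](bigID (fun n => c / N%:R <= F n))/=.
  rewrite (eq_bigl (fun n => ~~ sp n && (c / N%:R <= F n))); last first.
    by move=> n; rewrite andbC.
  rewrite [X in _ = _ + X - _](eq_bigl (fun n => ~~ sp n && (F n < c / N%:R))) ?addrK//.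
  by move=> n; rewrite -ltNge.
by apply: eq_bigl => n; rewrite andbC.
Qed.

(** A non-special n has nonzero residue, where the cutoff leaves little to remove, or residue 0 at
    an odd level, where the whole sum is already small. *)
Lemma removed_sum_bound (c : R) K N L : 0 < c ->
  (q K <= N < q K.+1)%N -> cf_log_bound K L ->
  0 <= \sum_(1 <= n < N.+1 | ~~ sp n && (F n < c / N%:R)) (F n)^-1
    <= (4 * c + 9 * L) * N%:R.
Proof.
move=> c0 NK hL; have [p [D lev]] := cf_levelP alpha_irr K.
have f1 n : (1 <= n < N.+1)%N -> 0 <= (F n)^-1 by move=> _; exact: fpartV_ge0.
rewrite sum_nat_ge0//= mulrDl.
have H := lerD (level_cutoff lev c0 NK) (odd_zero_res_bound lev NK hL).
apply: le_trans H; apply: sum_nat_le_or => // n /andP[n0 nN] /andP[ns ->].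
case: eqVneq => //= r0; rewrite andbT.
apply: (not_special_zero_res lev) ns _; last by rewrite r0.
by have /andP[_ Nq'] := NK; rewrite n0 (leq_trans nN).
Qed.

(** Here s collects the special n below q_K, of which only the size matters; the current level is
    kept explicit. *)
Lemma special_cutoff_split (c : R) K N L p D :
  cf_level alpha (odd K) (q K) (q K.+1) (a K.+1) p D ->
  (q K <= N < q K.+1)%N -> cf_log_bound K L ->
  exists2 s, 0 <= s <= 9 * L * N%:R &
    \sum_(1 <= n < N.+1 | sp n && (c / N%:R <= F n)) (F n)^-1 = s +
    if odd K then 0
    else \sum_(1 <= j < (N %/ q K).+1 | c / N%:R <= j%:R / D) D / j%:R.
Proof.
move=> lev NK hL; have /andP[qN Nq'] := NK; have L1 := cf_log_bound_ge1 hL.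
have q0 := cf_den_gt0 alpha_irr K.
exists (\sum_(1 <= n < q K | sp n && (c / N%:R <= F n)) (F n)^-1).
  have f1 n : (1 <= n < q K)%N -> 0 <= (F n)^-1 by move=> _; exact: fpartV_ge0.
  rewrite sum_nat_ge0//=; apply: le_trans (_ : 9 * L * (q K)%:R <= _).
    apply: le_trans (special_below hL).
    by apply: sum_nat_le_sub => // n _ /andP[].
  by rewrite ler_wpM2l ?ler_nat ?mulr_ge0//; lra.
rewrite [LHS](@big_cat_nat _ _ _ (q K))//= ?leqW//; congr (_ + _).
rewrite big_mkcondr sum_special_level//; case: ifPn => // oK.
rewrite [RHS]big_mkcond; apply: eq_big_nat => j /andP[j1 jB].
rewrite (level_even_fpart lev)// ?invf_div//.
by apply: leq_ltn_trans Nq'; rewrite -leq_divRL.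
Qed.

(** The 42 covers 24 for the regular sum, 9 for the removed terms and 9 for the special n of lower
    levels. *)
Lemma recip_sum_bound (c : R) K N L : 0 < c ->
  (q K <= N < q K.+1)%N -> cf_log_bound K L ->
  `|recip_sum c alpha N - N%:R * ln N%:R| <=
    (4 * c + 42 * L) * N%:R +
    (c^-1 + 3) * ((odd K.+1)%:R * Num.sqrt (a K.+1)%:R * N%:R).
Proof.
move=> c0 NK hL; have L1 := cf_log_bound_ge1 hL.
have [p [D lev]] := cf_levelP alpha_irr K.
have [s /andP[s0 s1] E] := special_cutoff_split c lev NK hL.
have /andP[r0 r1] := removed_sum_bound c0 NK hL.
have G := regular_sum_bound NK hL.
have D0 := level_D_pos lev.
rewrite recip_sum_split E /=.
set r := \sum_(_ <= _ < _ | ~~ sp _ && _) _ in r0 r1 *.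
set t := (X in s + X).
have [t0 t1] : 0 <= t /\ t <= (c^-1 + 3) * ((~~ odd K)%:R * Num.sqrt (a K.+1)%:R * N%:R).
  rewrite /t; case: ifPn => oK /=; first by rewrite !mul0r mulr0.
  rewrite mul1r; split; last exact: (level_even_cutoff_le lev c0 NK).
  by apply: sumr_ge0 => j _; rewrite divr_ge0// ltW.
have cN : 0 <= c * N%:R by rewrite mulr_ge0// ltW.
have LN : 0 <= L * N%:R by rewrite mulr_ge0//; lra.
move: G; rewrite !ler_norml => /andP[G1 G2].
by apply/andP; split; lra.
Qed.

Lemma recip_sum_lower (c : R) K N L : 0 < c ->
  (q K <= N < q K.+1)%N -> cf_log_bound K L ->
  4 * Num.sqrt (c * (a K.+1)%:R) * (q K)%:R <= N%:R -> ~~ odd K ->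
  N%:R * ln N%:R + (q K.+1)%:R - (4 * c + 3 / c + 33 * L) * N%:R <=
    recip_sum c alpha N.
Proof.
move=> c0 NK hL hyp oK; have L1 := cf_log_bound_ge1 hL.
have [p [D lev]] := cf_levelP alpha_irr K.
have [s /andP[s0 s1] E] := special_cutoff_split c lev NK hL.
have /andP[r0 r1] := removed_sum_bound c0 NK hL.
have G := regular_sum_bound NK hL.
have T := level_even_cutoff_ge lev c0 NK hyp.
rewrite recip_sum_split E (negbTE oK).
by move: G; rewrite !ler_norml => /andP[G1 G2]; lra.
Qed.

(** * The weighted sum *)

Lemma regular_weighted_bound K N L : (q K <= N < q K.+1)%N -> cf_log_bound K L ->
  `|\sum_(1 <= n < N.+1 | ~~ sp n) (n%:R * F n)^-1 - 2^-1 * ln N%:R ^+ 2|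
    <= (24 * L + 2) * (2 + ln N%:R).
Proof.
move=> NK hL; have L1 := cf_log_bound_ge1 hL.
(* The partial sums of g are the regular sums; each n <= N is estimated at its own level k <= K with
   the same L. *)
pose g n := if sp n then 0 else (F n)^-1.
have -> : \sum_(1 <= n < N.+1 | ~~ sp n) (n%:R * F n)^-1 =
    \sum_(1 <= n < N.+1) g n / n%:R.
  rewrite big_mkcond; apply: eq_bigr => n _; rewrite /g.
  by case: (sp n) => /=; rewrite ?mul0r// invfM mulrC.
apply: weighted_sum_bound => [|n nN]; first by rewrite mulr_ge0//; lra.
have -> : \sum_(1 <= m < n.+1) g m = regular_sum n.
  rewrite /regular_sum [RHS]big_mkcond; apply: eq_bigr => m _; rewrite /g.
  by case: (sp m).
have [->|n0] := posnP n.
  by rewrite /regular_sum big_geq// !mul0r mulr0 subr0 normr0.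
have /andP[_ Nq'] := NK.
have [k kK kn] := cf_level_exists n0 (leq_ltn_trans nN Nq').
by apply: regular_sum_bound kn _; apply: cf_log_boundW hL; rewrite -ltnS.
Qed.

Lemma special_weighted_level K N : (N < q K.+1)%N -> ~~ odd K ->
  forall p D, cf_level alpha (odd K) (q K) (q K.+1) (a K.+1) p D ->
  \sum_(q K <= n < N.+1 | sp n) (n%:R * F n)^-1 =
    \sum_(1 <= j < (N %/ q K).+1) D / j%:R / (j * q K)%:R.
Proof.
move=> NK oK p D lev; rewrite sum_special_level// (negbTE oK).
apply: eq_big_nat => j /andP[j1 jB].
rewrite invfM mulrC (level_even_fpart lev)// ?invf_div//.
by apply: leq_ltn_trans NK; rewrite -leq_divRL ?cf_den_gt0.
Qed.

(** The even level k carries a_(k+1), hence the odd indices in the sum; every complete level costs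
    at most 24. *)
Lemma special_weighted_below K :
  `|\sum_(1 <= n < q K | sp n) (n%:R * F n)^-1
    - pi ^+ 2 / 6 * (\sum_(1 <= k < K.+1 | odd k) pquot alpha k)%:~R| <= 24 * K%:R.
Proof.
elim: K => [|K IH].
  by rewrite cf_den0// !big_geq// mulr0 subr0 normr0 mulr0.
have q0 := cf_den_gt0 alpha_irr K; have q'0 := cf_den_gt0 alpha_irr K.+1.
rewrite (@big_cat_nat _ _ _ (q K))//= ?cf_den_le//.
rewrite [X in pi ^+ 2 / 6 * X%:~R]big_mkcond big_nat_recr//= -big_mkcond/=.
rewrite intrD mulrDr opprD addrACA -[K.+1%:R]natr1 mulrDr mulr1.
apply: le_trans (ler_normD _ _) _; apply: lerD => //.
rewrite -(prednK q'0); case: ifPn => oK.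
  have [p [D lev]] := cf_levelP alpha_irr K.
  rewrite (special_weighted_level _ oK lev); last by rewrite prednK.
  by rewrite pquot_natr mulrC; exact: (level_even_weighted_full lev).
rewrite sum_special_level ?prednK// (negbNE oK).
by rewrite mulr0 subr0 normr0.
Qed.

(** Two-step induction from q_(K+2) >= 2 q_K. *)
Lemma cf_den_growth K : (2 ^ K <= 2 * q K ^ 2)%N.
Proof.
suff : (2 ^ K <= 2 * q K ^ 2)%N /\ (2 ^ K.+1 <= 2 * q K.+1 ^ 2)%N by case.
elim: K => [|K [IH1 IH2]].
  by rewrite cf_den0//; split=> //; rewrite expn1 leq_pmulr// sqrn_gt0 cf_den_gt0.
split => //; have : (2 * q K <= q K.+2)%N.
  rewrite cf_denSS// mul2n -addnn leq_add2r.
  rewrite (leq_trans (cf_den_le alpha_irr K))// leq_pmull//.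
  by rewrite absz_gt0 gt_eqF// pquot_gt0.
move=> h; have := leq_mul h h; move: IH1; rewrite mulnACA !expnS expn0 !muln1.
by move: (2 ^ K)%N (q K * q K)%N (q K.+2 * q K.+2)%N; clear; lia.
Qed.

(** Makes an error proportional to the number of levels O(log N). With ln 2 >= 1/2, the growth bound
    gives (K-1)/2 <= 2 ln N when K > 1. *)
Lemma cf_level_le_ln K N : (q K <= N)%N -> K%:R <= 1 + 4 * ln N%:R :> R.
Proof.
move=> qN; have q0 := cf_den_gt0 alpha_irr K.
have : (2 ^ K <= 2 * N ^ 2)%N.
  by apply: leq_trans (cf_den_growth K) _; rewrite leq_mul2l leq_exp2r.
move=> /(ler_ln_nat R); rewrite natrX natrM natrX.
have NR : 0 < N%:R :> R by rewrite ltr0n (leq_trans q0).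
rewrite lnM ?posrE ?exprn_gt0// !lnXn// -[ln 2 *+ K]mulr_natl.
have [/= l2 _] := @ln_natS_bounds R 1 isT; rewrite ln1 subr0 in l2.
have N0 := ln_nat_ge0 R N.
move: (ln 2) l2 => l l2 H.
have [K1|K1] := leP K%:R (1 : R); first lra.
have := ler_wpM2r (_ : 0 <= K%:R - 1) l2; rewrite subr_ge0 ltW// => /(_ isT); lra.
Qed.

Lemma weighted_recip_sum_bound K N L : (q K <= N < q K.+1)%N -> cf_log_bound K L ->
  `|weighted_recip_sum alpha N - (2^-1 * ln N%:R ^+ 2
      + pi ^+ 2 / 6 * (\sum_(1 <= k < K.+1 | odd k) pquot alpha k)%:~R
      + (odd K.+1)%:R * (a K.+1)%:R * invsq_sum R (N %/ q K))|
  <= (24 * L + 2) * (2 + ln N%:R) + 24 * K%:R + 4.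
Proof.
move=> NK hL; have /andP[qN Nq'] := NK; have q0 := cf_den_gt0 alpha_irr K.
have H1 := regular_weighted_bound NK hL; have H2 := special_weighted_below K.
have H3 : `|\sum_(q K <= n < N.+1 | sp n) (n%:R * F n)^-1
    - (odd K.+1)%:R * (a K.+1)%:R * invsq_sum R (N %/ q K)| <= 4.
  have [p [D lev]] := cf_levelP alpha_irr K; rewrite /=.
  have [oK|oK] := boolP (odd K).
    by rewrite sum_special_level// oK !mul0r subr0 normr0.
  by rewrite (special_weighted_level Nq' oK lev)/= mul1r; exact: (level_even_weighted lev).
have -> : weighted_recip_sum alpha N =
    \sum_(1 <= n < N.+1 | ~~ sp n) (n%:R * F n)^-1 +
    (\sum_(1 <= n < q K | sp n) (n%:R * F n)^-1
     + \sum_(q K <= n < N.+1 | sp n) (n%:R * F n)^-1).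
  rewrite /weighted_recip_sum (bigID sp)/= addrC; congr (_ + _).
  by rewrite (@big_cat_nat _ _ _ (q K))//= leqW.
move: H1 H2 H3; rewrite !ler_norml => /andP[? ?] /andP[? ?] /andP[? ?].
by apply/andP; split; lra.
Qed.

End Main.

(** * The truncated logarithm in the error terms *)

Section ErrorTerm.
Variable R : realType.

Lemma elog_ge1 (x : R) : 1 <= elog x.
Proof.
rewrite /elog -{1}(expRK (1 : R)) ler_ln ?posrE ?expR_gt0//.
  by rewrite le_max lexx.
by rewrite lt_max expR_gt0.
Qed.

Lemma ln_le_elog (x : R) : 0 < x -> ln x <= elog x.
Proof.
move=> x0; rewrite /elog ler_ln ?posrE//; first by rewrite le_max lexx orbT.
by rewrite lt_max x0 orbT.
Qed.

(** Each a_(k+1) is a term of s_(K+1); the factor 2 absorbs the 1 in 1 + ln a_(k+1). *)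
Lemma cf_log_bound_elog (alpha : R) K : irrational alpha ->
  cf_log_bound alpha K (2 * elog (pquot_sum alpha K.+1)%:~R).
Proof.
move=> ia k kK; set s := (pquot_sum alpha K.+1)%:~R.
have sa : (`|pquot alpha k.+1|%N)%:R <= s.
  rewrite /s -[X in X <= _]/((`|pquot alpha k.+1|%N)%:Z%:~R) -pquot_abs// ler_int.
  rewrite /pquot_sum (bigD1_seq k.+1); [|by rewrite mem_index_iota !ltnS|exact: iota_uniq].
  rewrite /= lerDl big_seq_cond; apply: sumr_ge0 => i.
  rewrite mem_index_iota => /andP[/andP[i1 _] _].
  by rewrite -(prednK i1) ltW// pquot_gt0.
have a1 : 0 < (`|pquot alpha k.+1|%N)%:R :> R.
  by rewrite ltr0n absz_gt0 gt_eqF// pquot_gt0.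
have := elog_ge1 s; have := ln_le_elog (lt_le_trans a1 sa).
have : ln (`|pquot alpha k.+1|%N)%:R <= ln s.
  by rewrite ler_ln ?posrE// (lt_le_trans a1).
lra.
Qed.

End ErrorTerm.

(** * Choice of the implied constants *)

Theorem theorem5 (R : realType) :
  (forall c : R, 0 < c ->
    (exists C : R, forall (alpha : R) (K N : nat),
      irrational alpha ->
      (cf_den alpha K <= N < cf_den alpha K.+1)%N ->
      `|recip_sum c alpha N - N%:R * ln N%:R|
        <= C * (((odd K.+1)%:R * Num.sqrt (pquot alpha K.+1)%:~R
                 + elog (pquot_sum alpha K.+1)%:~R) * N%:R))
    /\
    (exists C : R, forall (alpha : R) (K N : nat),
      irrational alpha ->
      (cf_den alpha K <= N < cf_den alpha K.+1)%N ->
      4 * Num.sqrt (c * (pquot alpha K.+1)%:~R) * (cf_den alpha K)%:R <= N%:R ->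
      odd K.+1 ->
      N%:R * ln N%:R + (cf_den alpha K.+1)%:R
        - C * (elog (pquot_sum alpha K.+1)%:~R * N%:R)
        <= recip_sum c alpha N))
  /\
  (exists C : R, forall (alpha : R) (K N : nat),
    irrational alpha ->
    (cf_den alpha K <= N < cf_den alpha K.+1)%N ->
    `|weighted_recip_sum alpha N
      - (2^-1 * (ln N%:R) ^+ 2
         + pi ^+ 2 / 6 * (\sum_(1 <= k < K.+1 | odd k) pquot alpha k)%:~R
         + (odd K.+1)%:R * (pquot alpha K.+1)%:~R
           * \sum_(1 <= j < N.+1 | j%:R <= N%:R / (cf_den alpha K)%:R :> R)
               (j%:R ^+ 2)^-1)|
      <= C * (\sum_(1 <= k < K.+2 | odd k)
                Num.sqrt (pquot alpha k)%:~R * elog (pquot alpha k)%:~R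
              + elog (pquot_sum alpha K.+1)%:~R * elog N%:R)).
Proof.
split=> [c c0|].
  split.
    (* 84 = 2 * 42, as L is twice the truncated logarithm of s_(K+1). *)
    exists (84 + 4 * c + (c^-1 + 3)) => alpha K N ia NK.
    have := recip_sum_bound ia c0 NK (cf_log_bound_elog ia).
    rewrite pquot_natr// => /le_trans; apply.
    have := elog_ge1 ((pquot_sum alpha K.+1)%:~R : R).
    set l := elog _; set s := _ * Num.sqrt _ => l1.
    have s0 : 0 <= s by rewrite /s mulr_ge0 ?sqrtr_ge0.
    have N0 : 0 <= N%:R :> R by [].
    have ci : 0 <= c^-1 by rewrite invr_ge0 ltW.
    have := ltW c0; move: c^-1 ci N%:R N0 => d d0 n n0 c1.
    have sn : 0 <= s * n by rewrite mulr_ge0.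
    have n1 : n <= l * n by rewrite ler_peMl.
    have : 0 <= c * (l * n - n) by rewrite mulr_ge0// subr_ge0.
    have : 0 <= c * (s * n) by rewrite mulr_ge0.
    have : 0 <= d * (l * n) by rewrite !mulr_ge0//; lra.
    have : 0 <= l * n by rewrite mulr_ge0//; lra.
    lra.
  (* 66 = 2 * 33, for the same reason. *)
  exists (66 + 4 * c + 3 / c) => alpha K N ia NK hyp oK.
  rewrite pquot_natr// in hyp.
  have := recip_sum_lower ia c0 NK (cf_log_bound_elog ia) hyp oK.
  apply: le_trans; rewrite lerD2l lerN2.
  have := elog_ge1 ((pquot_sum alpha K.+1)%:~R : R).
  set l := elog _ => l1.
  have N0 : 0 <= N%:R :> R by [].
  have ci : 0 <= c^-1 by rewrite invr_ge0 ltW.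
  have := ltW c0; move: c^-1 ci N%:R N0 => d d0 n n0 c1.
  have n1 : n <= l * n by rewrite ler_peMl.
  have : 0 <= c * (l * n - n) by rewrite mulr_ge0// subr_ge0.
  have : 0 <= d * (l * n - n) by rewrite mulr_ge0// subr_ge0.
  lra.
(* The total is 150 + 24 + 96 + 4 = 274: 150 from the regular part, 24 + 96 from 24 K with K <= 1 +
   4 ln N, and 4 from the current level. *)
exists 300 => alpha K N ia NK.
have := weighted_recip_sum_bound ia NK (cf_log_bound_elog ia).
have q0 := cf_den_gt0 ia K.
have N0 : (0 < N)%N by have /andP[qN _] := NK; exact: leq_trans qN.
have -> : \sum_(1 <= j < N.+1 | j%:R <= N%:R / (cf_den alpha K)%:R :> R) (j%:R ^+ 2)^-1
    = invsq_sum R (N %/ cf_den alpha K).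
  rewrite /invsq_sum [RHS](@big_nat_widen _ _ _ _ _ N.+1) ?ltnS ?leq_div//.
  apply: eq_bigl => j; rewrite ler_pdivlMr ?ltr0n// -natrM ler_nat ltnS/=.
  by rewrite leq_divRL.
rewrite pquot_natr// => /le_trans; apply.
have /andP[qN _] := NK; have := cf_level_le_ln ia qN.
have : ln N%:R <= elog (N%:R : R) by apply: ln_le_elog; rewrite ltr0n.
have := elog_ge1 (N%:R : R); have := elog_ge1 ((pquot_sum alpha K.+1)%:~R : R).
have S0 : 0 <= \sum_(1 <= k < K.+2 | odd k)
    Num.sqrt (pquot alpha k)%:~R * elog (pquot alpha k)%:~R :> R.
  by apply: sumr_ge0 => k _; rewrite mulr_ge0 ?sqrtr_ge0// (le_trans ler01)// elog_ge1.
have := ln_nat_ge0 R N.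
move: (\sum_(1 <= k < K.+2 | odd k) _) S0 => S S0.
move: (elog _) (elog _) (ln _) K%:R => l m x k x0 l1 m1 xm kx.
have : (48 * m + 2) * (2 + x) <= (50 * m) * (3 * l) by apply: ler_pM; lra.
have : l <= m * l by rewrite ler_peMl//; lra.
lra.
Qed.
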